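(* Let $K$ be a field of characteristic different from $2$, let $X=Y\cup Z$, where $Y$ and $Z$ are disjoint well-ordered sets of even and odd free generators respectively, and let $F(\mathfrak B_{\rm sup})$ be the free bicommutative superalgebra over $K$ freely generated by $X$. Then the set $X\cup M$ is a basis of the vector space $F(\mathfrak B_{\rm sup})$, and the superalgebra $F(\mathfrak B_{\rm sup})$ is isomorphic to the superalgebra $G_{\rm sup}(X)$.
   Context: Algebras are not assumed associative or unital. A superalgebra is an algebra $A=A_0\oplus A_1$ with $A_iA_j\subseteq A_{i+j\,(\mathrm{mod}\,2)}$; for $a\in A_i$ write $\overline a=i$ (parity). A superalgebra is bicommutative if for all homogeneous elements $x_1(x_2x_3)=(-1)^{\overline{x_1}\,\overline{x_2}}x_2(x_1x_3)$ and $(x_1x_2)x_3=(-1)^{\overline{x_2}\,\overline{x_3}}(x_1x_3)x_2$. The free bicommutative superalgebra on $X=Y\cup Z$ ($Y$ even, $Z$ odd) is the one with the universal property that every parity-preserving map from $X$ to a bicommutative superalgebra $A$ extends uniquely to a superalgebra homomorphism to $A$. The set $M$: it consists of all monomials $$y_1(\cdots(y_k(z_1(\cdots(z_{l-1}((\cdots(((\cdots(z_ly_{k+1})\cdots)y_{k+m})z_{l+1})\cdots)z_{l+n}))\cdots)))\cdots)$$ with $k,l,m,n\ge 0$, $k+l>0$, $m+n>0$, $y_1,\dots,y_{k+m}\in Y$, $z_1,\dots,z_{l+n}\in Z$, $y_1\le\cdots\le y_k$, $y_{k+1}\le\cdots\le y_{k+m}$, $z_1<\cdots<z_l$, $z_{l+1}<\cdots<z_{l+n}$.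 In other words, writing $(a_1,\dots,a_r)=(y_1,\dots,y_k,z_1,\dots,z_l)$ and $(b_1,\dots,b_s)=(y_{k+1},\dots,y_{k+m},z_{l+1},\dots,z_{l+n})$, the monomial is $a_1(a_2(\cdots(a_{r-1}((\cdots((a_rb_1)b_2)\cdots)b_s))\cdots))$. The superalgebra $G_{\rm sup}(X)$: let $F(\mathfrak A_{\rm sup})$ be the free unital associative super-commutative superalgebra on $X$ (relations $yx=xy$ for $x\in X,y\in Y$, and $z_2z_1=-z_1z_2$ for $z_1,z_2\in Z$), with basis $y_1\cdots y_kz_1\cdots z_l$, $y_1\le\cdots\le y_k$, $z_1<\cdots<z_l$; let $\omega=\omega(F(\mathfrak A_{\rm sup}))$ be its augmentation ideal (elements without constant term). Then $G_{\rm sup}(X)=KX\oplus(\omega\otimes_K\omega)$, where $KX$ is the vector space with basis $X$, with bilinear multiplication given, for homogeneous elements, by $x_i\circ x_j=x_i\otimes x_j$ for $x_i,x_j\in X$; $x\circ(u\otimes v)=(xu)\otimes v$ and $(u\otimes v)\circ x=u\otimes(vx)$ for $x\in X$, $u,v\in\omega$; and $(u_1\otimes v_1)\circ(u_2\otimes v_2)=(-1)^{\overline{v_1}(\overline{u_2}+\overline{v_2})}(u_1u_2)\otimes(v_2v_1)$ for $u_i,v_i\in\omega$. Parity: $\overline{u\otimes v}\equiv\overline u+\overline v\pmod 2$, and elements of $X$ keep their parity. *)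

(* Defs.v *)
From HB Require Import structures.
From mathcomp Require Import all_boot all_order all_algebra finmap.

Set Implicit Arguments.
Unset Strict Implicit.
Unset Printing Implicit Defensive.

Import Order.TTheory GRing.Theory.
Local Open Scope ring_scope.

(* Neither associativity nor a unit is assumed.  [parity i a] reads "a lies in
   A_i", with [false] for the even and [true] for the odd component; in
   particular 0 is homogeneous of both parities. *)
HB.mixin Record Lmodule_isSuperalgebra (K : fieldType) A
    of GRing.Lmodule K A := {
  smul : A -> A -> A;
  parity : bool -> A -> Prop;
  smul_bilinear : bilinear_for *:%R *:%R smul;
  parity0 : forall i, parity i 0;
  parityP : forall i (c : K) a b,
    parity i a -> parity i b -> parity i (c *: a + b);
  parity_sum : forall a, exists a0 a1,
    [/\ parity false a0, parity true a1 & a = a0 + a1];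
  parity_direct : forall a, parity false a -> parity true a -> a = 0;
  parityM : forall i j a b,
    parity i a -> parity j b -> parity (i (+) j) (smul a b)
}.

#[short(type="superalgType")]
HB.structure Definition Superalgebra (K : fieldType) :=
  {A of GRing.Lmodule K A & Lmodule_isSuperalgebra K A}.

Declare Scope super_scope.
Delimit Scope super_scope with S.
Notation "a ∘ b" := (smul a b) (at level 40, left associativity) : super_scope.
Local Open Scope super_scope.

Definition superhom (K : fieldType) (A B : superalgType K) (f : A -> B) : Prop :=
  [/\ linear f,
      {morph f : a b / a ∘ b} &
      forall i a, parity i a -> parity i (f a)].

Definition superisomorphic (K : fieldType) (A B : superalgType K) : Prop :=
  exists2 f : A -> B, superhom f & bijective f.

Definition bicommutative (K : fieldType) (A : superalgType K) : Prop :=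
  forall (i1 i2 i3 : bool) (x1 x2 x3 : A),
    parity i1 x1 -> parity i2 x2 -> parity i3 x3 ->
    x1 ∘ (x2 ∘ x3) = (-1) ^+ (i1 && i2) *: (x2 ∘ (x1 ∘ x3)) /\
    (x1 ∘ x2) ∘ x3 = (-1) ^+ (i2 && i3) *: ((x1 ∘ x3) ∘ x2).

(* The set X of generators is the disjoint union Y + Z. *)
Definition gen_parity (Y Z : Type) (x : Y + Z) : bool :=
  if x is inr _ then true else false.

Definition parity_preserving (Y Z : Type) (K : fieldType) (A : superalgType K)
    (f : Y + Z -> A) : Prop :=
  forall x, parity (gen_parity x) (f x).

Definition free_bicommutative (Y Z : Type) (K : fieldType)
    (F : superalgType K) (iota : Y + Z -> F) : Prop :=
  [/\ bicommutative F,
      parity_preserving iota &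
      forall (A : superalgType K) (f : Y + Z -> A),
        bicommutative A -> parity_preserving f ->
        exists phi : F -> A,
          [/\ superhom phi,
              forall x, phi (iota x) = f x &
              forall psi : F -> A, superhom psi ->
                (forall x, psi (iota x) = f x) -> psi =1 phi]].

(* Bases are families indexed by I, so that the vectors v i are in particular
   pairwise distinct. *)
Definition is_basis (K : fieldType) (V : lmodType K) (I : eqType)
    (v : I -> V) : Prop :=
  (forall x : V, exists (s : seq I) (c : I -> K),
     x = \sum_(i <- s) c i *: v i) /\
  (forall (s : seq I) (c : I -> K), uniq s ->
     \sum_(i <- s) c i *: v i = 0 -> {in s, forall i, c i = 0}).

Record freemod (K : fieldType) (M : choiceType) :=
  Freemod { fmcoef : {fsfun M -> K with 0} }.

HB.instance Definition _ (K : fieldType) (M : choiceType) :=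
  [isNew for @fmcoef K M].
HB.instance Definition _ (K : fieldType) (M : choiceType) :=
  [Choice of freemod K M by <:].

Notation "u @_ m" := (fmcoef u m)
  (at level 3, m at level 2, left associativity, format "u @_ m") : ring_scope.
Notation fmsupp u := (finsupp (fmcoef u)).

(* The operations are locked to keep unification from unfolding them. *)
HB.lock Definition fm_lincomb (K : fieldType) (M : choiceType) (c : K)
    (u v : freemod K M) : freemod K M :=
  Freemod [fsfun m in (fmsupp u `|` fmsupp v)%fset => c * u@_m + v@_m].

HB.lock Definition fm_basis (K : fieldType) (M : choiceType) (m : M) :
    freemod K M := Freemod [fsfun k in [fset m]%fset => 1].

HB.lock Definition linext (K : fieldType) (M : choiceType) (V : lmodType K)
    (f : M -> V) (u : freemod K M) : V :=
  \sum_(m <- fmsupp u) u@_m *: f m.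

Arguments fm_lincomb {K M} c u v.
Arguments fm_basis K {M} m.
Arguments linext {K M V} f u.

Section FreeModule.
Context (K : fieldType) (M : choiceType).
Local Notation fm := (freemod K M).
Implicit Types (u v w : fm) (c : K) (m k : M).

Lemma freemodP u v : (forall m, u@_m = v@_m) -> u = v.
Proof. by move=> e; apply: val_inj; apply/fsfunP. Qed.

Definition fm_zero : fm := Freemod [fsfun].
Definition fm_add u v := fm_lincomb 1 u v.
Definition fm_scale c u := fm_lincomb c u fm_zero.
Definition fm_opp u := fm_scale (-1) u.

Lemma fm_lincombE c u v m : (fm_lincomb c u v)@_m = c * u@_m + v@_m.
Proof.
rewrite fm_lincomb.unlock fsfunE inE.
case: ifP => // /negbT; rewrite negb_or => /andP[/fsfun_dflt-> /fsfun_dflt->].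
by rewrite mulr0 addr0.
Qed.

Lemma fm_zeroE m : fm_zero@_m = 0. Proof. by rewrite fsfunE. Qed.

Let fmE := (fm_lincombE, fm_zeroE, mul1r, mulN1r, addr0, add0r).

Lemma fm_addA : associative fm_add.
Proof. by move=> u v w; apply: freemodP => m; rewrite !fmE addrA. Qed.
Lemma fm_addC : commutative fm_add.
Proof. by move=> u v; apply: freemodP => m; rewrite !fmE addrC. Qed.
Lemma fm_add0 : left_id fm_zero fm_add.
Proof. by move=> u; apply: freemodP => m; rewrite !fmE. Qed.
Lemma fm_addN : left_inverse fm_zero fm_opp fm_add.
Proof. by move=> u; apply: freemodP => m; rewrite !fmE addNr. Qed.

HB.instance Definition _ :=
  GRing.isZmodule.Build fm fm_addA fm_addC fm_add0 fm_addN.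

Lemma fmcoef0 m : (0 : fm)@_m = 0. Proof. exact: fm_zeroE. Qed.
Lemma fmcoefD u v m : (u + v)@_m = u@_m + v@_m.
Proof. by rewrite fm_lincombE mul1r. Qed.

Lemma fm_scaleA c d u : fm_scale c (fm_scale d u) = fm_scale (c * d) u.
Proof. by apply: freemodP => m; rewrite !fmE mulrA. Qed.
Lemma fm_scale1 : left_id 1 fm_scale.
Proof. by move=> u; apply: freemodP => m; rewrite !fmE. Qed.
Lemma fm_scaleDr : right_distributive fm_scale +%R.
Proof.
by move=> c u v; apply: freemodP => m; rewrite fmcoefD !fmE mulrDr.
Qed.
Lemma fm_scaleDl u : {morph fm_scale^~ u : c d / c + d}.
Proof.
by move=> c d; apply: freemodP => m; rewrite fmcoefD !fmE /= mulrDl.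
Qed.

HB.instance Definition _ := GRing.Zmodule_isLmodule.Build K fm
  fm_scaleA fm_scale1 fm_scaleDr fm_scaleDl.

Lemma fmcoefZ c u m : (c *: u)@_m = c * u@_m.
Proof. by rewrite fm_lincombE fm_zeroE addr0. Qed.

Lemma fmcoef_is_linear m : scalar (fun u => u@_m).
Proof. by move=> c u v; rewrite fmcoefD fmcoefZ. Qed.

Lemma fmcoef_basis m k : (fm_basis K m)@_k = (k == m)%:R.
Proof. by rewrite fm_basis.unlock fsfunE inE; case: eqP. Qed.

Lemma fmsupp_basis m : fmsupp (fm_basis K m) = [fset m]%fset.
Proof.
apply/fsetP => k; rewrite inE mem_finsupp fmcoef_basis.
by case: (k == m); rewrite ?oner_neq0 ?eqxx.
Qed.

Section Extension.
Context (V : lmodType K).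
Implicit Type (f : M -> V).

Lemma linextEw f u (d : {fset M}) : (fmsupp u `<=` d)%fset ->
  linext f u = \sum_(m <- d) u@_m *: f m.
Proof.
move=> le; rewrite linext.unlock (big_fset_incl _ le) // => m _.
by move/fsfun_dflt->; rewrite scale0r.
Qed.

Lemma linext_is_linear f : linear (linext f).
Proof.
move=> c u v; pose d := (fmsupp u `|` fmsupp v `|` fmsupp (c *: u + v)%R)%fset.
have Hu : (fmsupp u `<=` d)%fset by rewrite /d -fsetUA fsubsetUl.
have Hv : (fmsupp v `<=` d)%fset.
  by apply: fsubset_trans (fsubsetUl _ _); apply: fsubsetUr.
rewrite (@linextEw f _ d) ?fsubsetUr // (linextEw f Hu) (linextEw f Hv).
rewrite scaler_sumr -big_split /=; apply: eq_bigr => m _.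
by rewrite fmcoefD fmcoefZ scalerDl scalerA.
Qed.

HB.instance Definition _ f :=
  GRing.isLinear.Build K fm V *:%R (linext f) (linext_is_linear f).

Lemma linextU f m : linext f (fm_basis K m) = f m.
Proof.
by rewrite linext.unlock fmsupp_basis big_seq_fset1 fmcoef_basis eqxx scale1r.
Qed.

End Extension.

Lemma freemodE u : u = linext (fm_basis K) u.
Proof.
apply: freemodP => k; rewrite linext.unlock.
pose g : {scalar fm} := HB.pack (fun u : fm => u@_k)
  (GRing.isLinear.Build K fm K *%R (fun u : fm => u@_k) (fmcoef_is_linear k)).
rewrite -[RHS]/(g _) linear_sum /= (eq_bigr (fun m => (m == k)%:R * u@_k)).
  rewrite -big_distrl /=; have [ku|/fsfun_dflt->] := boolP (k \in fmsupp u).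
    rewrite (big_fsetD1 k ku) /= eqxx big_seq big1 ?addr0 ?mul1r // => m.
    by rewrite !inE => /andP[/negPf-> _].
  by rewrite mulr0.
move=> m _; rewrite fmcoefZ fmcoef_basis eq_sym; case: eqP => [->|_].
  by rewrite mulr1 mul1r.
by rewrite mulr0 mul0r.
Qed.

Lemma freemod_lin_eq (V : lmodType K) (f g : fm -> V) :
  linear f -> linear g ->
  (forall m, f (fm_basis K m) = g (fm_basis K m)) -> f =1 g.
Proof.
move=> lf lg fg u.
pose f' : {linear _ -> _} :=
  HB.pack f (GRing.isLinear.Build K fm V *:%R f lf).
pose g' : {linear _ -> _} :=
  HB.pack g (GRing.isLinear.Build K fm V *:%R g lg).
rewrite -[f]/(f' : _ -> _) -[g]/(g' : _ -> _) [u]freemodE linext.unlock.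
by rewrite !linear_sum; apply: eq_bigr => m _; rewrite !linearZ /= fg.
Qed.

Definition fm_parity (deg : M -> bool) (i : bool) u : Prop :=
  forall m, u@_m != 0 -> deg m = i.

Lemma fm_parity0 deg i : fm_parity deg i 0.
Proof. by move=> m; rewrite fmcoef0 eqxx. Qed.

Lemma fm_parityP deg i c u v :
  fm_parity deg i u -> fm_parity deg i v -> fm_parity deg i (c *: u + v).
Proof.
move=> hu hv m; rewrite fmcoefD fmcoefZ => nz.
have [u0|/hu//] := eqVneq u@_m 0; apply: hv; apply: contraNneq nz => ->.
by rewrite u0 mulr0 addr0.
Qed.

Lemma fm_parity_basis deg m : fm_parity deg (deg m) (fm_basis K m).
Proof.
by move=> k; rewrite fmcoef_basis; have [->|_] := eqVneq k m; rewrite ?eqxx.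
Qed.

Lemma linext_ind (V : lmodType K) (P : V -> Prop) (f : M -> V) u :
  P 0 -> (forall c a b, P a -> P b -> P (c *: a + b)) ->
  (forall m, u@_m != 0 -> P (f m)) -> P (linext f u).
Proof.
move=> P0 PP Pf; rewrite linext.unlock big_seq.
apply: (big_ind P) => [//|a b Pa Pb|m].
  by rewrite -[a]scale1r; apply: PP.
rewrite mem_finsupp => /Pf Pm.
by rewrite -[_ *: _]addr0; apply: PP.
Qed.

Lemma fm_parity_sum deg u : exists u0 u1,
  [/\ fm_parity deg false u0, fm_parity deg true u1 & u = u0 + u1].
Proof.
pose part i := linext (fun m => if deg m == i then fm_basis K m else 0) u.
have hp i : fm_parity deg i (part i).
  apply: linext_ind; first exact: fm_parity0.
    by move=> c a b; apply: fm_parityP.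
  move=> m _; case: eqP => [<-|_]; first exact: fm_parity_basis.
  exact: fm_parity0.
exists (part false), (part true); split=> //.
rewrite {1}[u]freemodE /part linext.unlock -big_split /=.
apply: eq_bigr => m _; rewrite -scalerDr.
by case: (deg m); rewrite /= ?addr0 ?add0r.
Qed.

Lemma fm_parity_direct deg u :
  fm_parity deg false u -> fm_parity deg true u -> u = 0.
Proof.
move=> h0 h1; apply: freemodP => m; rewrite fmcoef0.
by apply/eqP/negPn/negP => nz; have := h0 m nz; rewrite h1.
Qed.

End FreeModule.

Definition linext2 (K : fieldType) (M N : choiceType) (V : lmodType K)
    (f : M -> N -> V) (u : freemod K M) (v : freemod K N) : V :=
  linext (fun m => linext (f m) v) u.

Lemma linext2_bilinear (K : fieldType) (M N : choiceType) (V : lmodType K)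
  (f : M -> N -> V) : bilinear_for *:%R *:%R (linext2 f).
Proof.
split=> [v|u] c a b; first exact: linearP.
rewrite /= /linext2 !(linextEw _ (fsubset_refl (fmsupp u))) scaler_sumr.
rewrite -big_split /=; apply: eq_bigr => m _.
by rewrite linearP scalerDr !scalerA mulrC.
Qed.

Lemma linext2Pl (K : fieldType) (M N : choiceType) (V : lmodType K)
  (f : M -> N -> V) c u u' v :
  linext2 f (c *: u + u') v = c *: linext2 f u v + linext2 f u' v.
Proof. exact: (linext2_bilinear f).1. Qed.

Lemma linext2Pr (K : fieldType) (M N : choiceType) (V : lmodType K)
  (f : M -> N -> V) c u v v' :
  linext2 f u (c *: v + v') = c *: linext2 f u v + linext2 f u v'.
Proof. exact: (linext2_bilinear f).2. Qed.

Lemma linext20l (K : fieldType) (M N : choiceType) (V : lmodType K)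
  (f : M -> N -> V) v : linext2 f 0 v = 0.
Proof. by rewrite /linext2 linear0. Qed.

Lemma linext20r (K : fieldType) (M N : choiceType) (V : lmodType K)
  (f : M -> N -> V) u : linext2 f u 0 = 0.
Proof.
have /eqP := linext2Pr f 1 u 0 0.
by rewrite !scale1r addr0 -subr_eq subrr => /eqP.
Qed.

Lemma linext2U (K : fieldType) (M N : choiceType) (V : lmodType K)
  (f : M -> N -> V) m n : linext2 f (fm_basis K m) (fm_basis K n) = f m n.
Proof. by rewrite /linext2 !linextU. Qed.

Lemma fm_parity_linext2 (K : fieldType) (M N : choiceType) (V : lmodType K)
    (P : V -> Prop) (f : M -> N -> V) degM degN i j u v :
  P 0 -> (forall (c : K) a b, P a -> P b -> P (c *: a + b)) ->
  (forall m n, degM m = i -> degN n = j -> P (f m n)) ->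
  fm_parity degM i u -> fm_parity degN j v -> P (linext2 f u v).
Proof.
move=> P0 PP Pf hu hv; apply: linext_ind => // m /hu dm.
by apply: linext_ind => // n /hv dn; apply: Pf.
Qed.

Section Supercommutative.
Context (dY dZ : Order.disp_t) (Y : orderType dY) (Z : orderType dZ).

(* [SMon (ys, zs)] stands for the monomial y_1 ... y_k z_1 ... z_l. *)
Record smon := SMon {
  smon_val : seq Y * seq Z;
  _ : sorted <=%O smon_val.1 && sorted <%O smon_val.2
}.

HB.instance Definition _ := [isSub for smon_val].
HB.instance Definition _ := [Choice of smon by <:].

Definition smon1 : smon := @SMon ([::], [::]) isT.

Definition smon_parity (m : smon) : bool := odd (size (val m).2).

Definition smon_word (m : smon) : seq (Y + Z) :=
  map inl (val m).1 ++ map inr (val m).2.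

Fixpoint inversions (zs : seq Z) : nat :=
  if zs is z :: zs' then (count (fun t => t < z)%O zs' + inversions zs')%N
  else 0%N.

Context (K : fieldType).

(* The free unital associative super-commutative superalgebra F(A_sup) on
   X = Y + Z (for char K <> 2), realized on its basis of monomials.  It is made
   an [algType K] below; the defining relations of the generators
   [supercomm_gen] are [supercomm_gen_comm] and [supercomm_gen_anticomm], and
   [supercomm_monomialE] writes the basis elements as the products
   y_1 ... y_k z_1 ... z_l of generators. *)
Definition supercomm : Type := freemod K smon.
HB.instance Definition _ := GRing.Lmodule.on supercomm.

End Supercommutative.

(* Normal form of the product of the word [ys] by the word [zs]: sorting [zs]
   by transpositions z'z = -zz' costs one sign per inversion, and the product
   vanishes if some odd generator is repeated (zz = -zz), in which case the
   sorted word is not strictly increasing and [insub] fails. *)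
HB.lock Definition normal_form (dY dZ : Order.disp_t) (Y : orderType dY)
    (Z : orderType dZ) (K : fieldType) (ys : seq Y) (zs : seq Z) :
    supercomm Y Z K :=
  if insub (sort <=%O ys, sort <=%O zs) is Some m
  then (-1) ^+ inversions zs *: fm_basis K m else 0.

HB.lock Definition supercomm_mul (dY dZ : Order.disp_t) (Y : orderType dY)
    (Z : orderType dZ) (K : fieldType) (u v : supercomm Y Z K) :
    supercomm Y Z K :=
  linext2 (fun m n =>
    normal_form K ((val m).1 ++ (val n).1) ((val m).2 ++ (val n).2)) u v.

Arguments normal_form {dY dZ Y Z} K ys zs.
Arguments supercomm_mul {dY dZ Y Z K} u v.

Section SupercommutativeTheory.
Context (dY dZ : Order.disp_t) (Y : orderType dY) (Z : orderType dZ).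
Context (K : fieldType).
Local Notation smon := (smon Y Z).
Local Notation supercomm := (supercomm Y Z K).
Local Notation smon1 := (smon1 Y Z).
Local Notation normal_form := (@normal_form _ _ Y Z K).
Local Notation supercomm_mul := (@supercomm_mul _ _ Y Z K).

Definition supercomm_one : supercomm := fm_basis K smon1.

Lemma smon_sorted_uniq (zs : seq Z) :
  sorted <%O (sort <=%O zs) = uniq zs.
Proof. by rewrite lt_sorted_uniq_le sort_uniq sort_le_sorted andbT. Qed.

Lemma normal_formE ys zs :
  (exists m : smon, [/\ val m = (sort <=%O ys, sort <=%O zs), uniq zs &
     normal_form ys zs = (-1) ^+ inversions zs *: fm_basis K m])
  \/ (~~ uniq zs /\ normal_form ys zs = 0).
Proof.
rewrite normal_form.unlock; case: insubP => [m|] /=.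
  by rewrite smon_sorted_uniq => /andP[_ u] e; left; exists m.
by rewrite smon_sorted_uniq sort_le_sorted /= => u; right.
Qed.

Lemma inversions_sorted (zs : seq Z) : sorted <=%O zs -> inversions zs = 0%N.
Proof.
elim: zs => //= z zs IH p; rewrite IH ?(path_sorted p) // addn0.
apply/eqP; rewrite -leqn0 leqNgt -has_count; apply/hasPn => t tz.
by rewrite -leNgt; apply: (allP (order_path_min le_trans p)).
Qed.

Definition crossings (a b : seq Z) : nat :=
  (\sum_(z <- a) \sum_(t <- b) (t < z)%O)%N.

Lemma inversions_cat (a b : seq Z) :
  inversions (a ++ b) = (inversions a + inversions b + crossings a b)%N.
Proof.
elim: a => [|z a IH] /=; first by rewrite /crossings big_nil addn0.
rewrite IH /crossings big_cons count_cat -!addnA; congr addn.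
rewrite addnCA; congr addn; rewrite addnCA; congr addn; congr addn.
by rewrite -sum1_count big_mkcond; apply: eq_bigr => t _; case: (_ < _)%O.
Qed.

Lemma crossings_perm (a a' b b' : seq Z) :
  perm_eq a a' -> perm_eq b b' -> crossings a b = crossings a' b'.
Proof.
move=> pa pb; rewrite /crossings (perm_big _ pa) /=.
by apply: eq_bigr => z _; rewrite (perm_big _ pb).
Qed.

Lemma normal_formU (m : smon) :
  fm_basis K m = normal_form (val m).1 (val m).2 :> supercomm.
Proof.
have /andP[s1 s2] := valP m.
have s2' : sorted <=%O (val m).2 by apply: sub_sorted s2 => ? ? /ltW.
have u : uniq (val m).2 by rewrite -smon_sorted_uniq sort_le_id.
case: (normal_formE (val m).1 (val m).2) => [[n [en _ ->]]|[]]; last by rewrite u.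
rewrite inversions_sorted // scale1r; congr fm_basis; apply: val_inj.
by rewrite en !sort_le_id // -surjective_pairing.
Qed.

Lemma sort_cat_sort d (T : orderType d) (a b : seq T) :
  sort <=%O (sort <=%O a ++ sort <=%O b) = sort <=%O (a ++ b).
Proof.
apply/perm_sort_leP; apply: perm_cat; by rewrite perm_sort.
Qed.

Lemma supercomm_mulP : bilinear_for *:%R *:%R supercomm_mul.
Proof. by rewrite supercomm_mul.unlock; apply: linext2_bilinear. Qed.

Lemma supercomm_mul0l u : supercomm_mul 0 u = 0.
Proof. by rewrite supercomm_mul.unlock /linext2 linear0. Qed.

Lemma supercomm_mul0r u : supercomm_mul u 0 = 0.
Proof.
have := supercomm_mulP.2 u 1 0 0; rewrite /= !scale1r addr0 => /eqP.
by rewrite -subr_eq subrr => /eqP.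
Qed.

Lemma supercomm_mulZ c d u v :
  supercomm_mul (c *: u) (d *: v) = (c * d) *: supercomm_mul u v.
Proof.
have := supercomm_mulP.2 (c *: u) d v 0.
rewrite addr0 supercomm_mul0r addr0 => ->.
have := supercomm_mulP.1 v c u 0.
by rewrite /= addr0 supercomm_mul0l addr0 => ->; rewrite scalerA mulrC.
Qed.

Lemma normal_formM ys zs ys' zs' :
  supercomm_mul (normal_form ys zs) (normal_form ys' zs') =
  normal_form (ys ++ ys') (zs ++ zs').
Proof.
have nu (s t : seq Z) : ~~ uniq s || ~~ uniq t -> ~~ uniq (s ++ t).
  by rewrite cat_uniq; do !case: uniq => //=; rewrite andbF.
have nf0 s t : ~~ uniq t -> normal_form s t = 0.
  by case: (normal_formE s t) => [[n [_ -> //]]|[]].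
case: (normal_formE ys zs) => [[m [em um ->]]|[u ->]]; last first.
  by rewrite supercomm_mul0l nf0 // nu // u.
case: (normal_formE ys' zs') => [[n [en un ->]]|[u ->]]; last first.
  by rewrite supercomm_mul0r nf0 // nu // u orbT.
rewrite supercomm_mulZ supercomm_mul.unlock linext2U em en /=.
rewrite normal_form.unlock !sort_cat_sort; case: insub => [p|];
  last by rewrite scaler0.
rewrite scalerA -!exprD !inversions_cat (inversions_sorted (sort_le_sorted zs)).
rewrite (inversions_sorted (sort_le_sorted zs')) !add0n.
by rewrite (@crossings_perm _ zs _ zs') // perm_sort.
Qed.

Lemma supercomm_mulA : associative supercomm_mul.
Proof.
move=> u v w; move: u; apply: freemod_lin_eq.
- by move=> c a b; apply: supercomm_mulP.1.
- move=> c a b; rewrite (supercomm_mulP.1 v c a b : supercomm_mul _ _ = _).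
  exact: supercomm_mulP.1.
move=> m; move: v; apply: freemod_lin_eq.
- move=> c a b; rewrite (supercomm_mulP.1 w c a b : supercomm_mul _ _ = _).
  exact: supercomm_mulP.2.
- move=> c a b.
  rewrite (supercomm_mulP.2 (fm_basis K m) c a b : supercomm_mul _ _ = _).
  exact: supercomm_mulP.1.
move=> n; move: w; apply: freemod_lin_eq.
- move=> c a b.
  rewrite (supercomm_mulP.2 (fm_basis K n) c a b : supercomm_mul _ _ = _).
  exact: supercomm_mulP.2.
- by move=> c a b; apply: supercomm_mulP.2.
move=> p; rewrite (normal_formU m) (normal_formU n) (normal_formU p).
by rewrite !normal_formM !catA.
Qed.

Lemma supercomm_oneE : supercomm_one = normal_form [::] [::].
Proof. exact: normal_formU. Qed.

Lemma supercomm_mul1l : left_id supercomm_one supercomm_mul.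
Proof.
apply: freemod_lin_eq => [c a b|//|m]; first exact: supercomm_mulP.2.
by rewrite supercomm_oneE (normal_formU m) normal_formM.
Qed.

Lemma supercomm_mul1r : right_id supercomm_one supercomm_mul.
Proof.
apply: freemod_lin_eq => [c a b|//|m]; first exact: supercomm_mulP.1.
by rewrite supercomm_oneE (normal_formU m) normal_formM !cats0.
Qed.

Lemma supercomm_mulDl : left_distributive supercomm_mul +%R.
Proof.
by move=> u v w; have := supercomm_mulP.1 w 1 u v; rewrite /= !scale1r.
Qed.

Lemma supercomm_mulDr : right_distributive supercomm_mul +%R.
Proof.
by move=> u v w; have := supercomm_mulP.2 u 1 v w; rewrite /= !scale1r.
Qed.

Lemma supercomm_one_neq0 : supercomm_one != 0.
Proof. apply/eqP => /(congr1 (fun u : freemod K smon => u@_smon1)).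
by rewrite fmcoef_basis fmcoef0 eqxx => /eqP; rewrite oner_eq0. Qed.

HB.instance Definition _ := GRing.Zmodule_isNzRing.Build supercomm
  supercomm_mulA supercomm_mul1l supercomm_mul1r
  supercomm_mulDl supercomm_mulDr supercomm_one_neq0.

Lemma supercomm_scaleAl (c : K) (u v : supercomm) : c *: (u * v) = (c *: u) * v.
Proof. by have := supercomm_mulZ c 1 u v; rewrite scale1r mulr1. Qed.

HB.instance Definition _ :=
  GRing.Lmodule_isLalgebra.Build K supercomm supercomm_scaleAl.

Lemma supercomm_scaleAr (c : K) (u v : supercomm) : c *: (u * v) = u * (c *: v).
Proof. by have := supercomm_mulZ 1 c u v; rewrite scale1r mul1r. Qed.

HB.instance Definition _ :=
  GRing.Lalgebra_isAlgebra.Build K supercomm supercomm_scaleAr.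

Definition supercomm_gen (x : Y + Z) : supercomm :=
  match x with
  | inl y => normal_form [:: y] [::]
  | inr z => normal_form [::] [:: z]
  end.

Lemma supercomm_gen_comm x y :
  supercomm_gen (inl y) * supercomm_gen x =
  supercomm_gen x * supercomm_gen (inl y).
Proof.
rewrite /GRing.mul /=; case: x => [y'|z] /=; rewrite !normal_formM //=.
rewrite normal_form.unlock (_ : sort _ [:: y; y'] = sort <=%O [:: y'; y]) //.
by apply/perm_sort_leP; apply: (permEl (perm_catC [:: y] [:: y'])).
Qed.

Lemma supercomm_gen_anticomm z1 z2 :
  supercomm_gen (inr z2) * supercomm_gen (inr z1) =
  - (supercomm_gen (inr z1) * supercomm_gen (inr z2)).
Proof.
rewrite /GRing.mul /= !normal_formM normal_form.unlock /=.
rewrite (_ : sort _ [:: z2; z1] = sort <=%O [:: z1; z2]); last first.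
  by apply/perm_sort_leP; apply: (permEl (perm_catC [:: z2] [:: z1])).
case: insubP => [m|_]; last by rewrite oppr0.
rewrite smon_sorted_uniq /= inE andbT => ne _.
by case: ltgtP ne => //= _ _; rewrite !scale1r ?scaleN1r ?opprK.
Qed.

Lemma supercomm_monomialE (m : smon) :
  fm_basis K m = \prod_(x <- smon_word m) supercomm_gen x :> supercomm.
Proof.
rewrite normal_formU /smon_word big_cat !big_map /=.
have -> ys : \prod_(y <- ys) supercomm_gen (inl y) = normal_form ys [::].
  elim: ys => [|y ys IH]; first by rewrite big_nil -supercomm_oneE.
  by rewrite big_cons IH /GRing.mul /= normal_formM.
have -> zs : \prod_(z <- zs) supercomm_gen (inr z) = normal_form [::] zs.
  elim: zs => [|z zs IH]; first by rewrite big_nil -supercomm_oneE.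
  by rewrite big_cons IH /GRing.mul /= normal_formM.
by rewrite /GRing.mul /= normal_formM cats0.
Qed.

Definition supercomm_parity : bool -> supercomm -> Prop :=
  fm_parity (@smon_parity _ _ Y Z).

Lemma normal_form_parity ys zs :
  supercomm_parity (odd (size zs)) (normal_form ys zs).
Proof.
case: (normal_formE ys zs) => [[m [em _ ->]]|[_ ->]]; last exact: fm_parity0.
rewrite -[_ *: _]addr0; apply: fm_parityP; last exact: fm_parity0.
have := @fm_parity_basis K _ (@smon_parity _ _ Y Z) m.
by rewrite {2}/smon_parity em /= size_sort.
Qed.

Lemma supercomm_parityM i j (u v : supercomm) :
  supercomm_parity i u -> supercomm_parity j v ->
  supercomm_parity (i (+) j) (u * v).
Proof.
move=> hu hv; rewrite /GRing.mul /= supercomm_mul.unlock.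
apply: (fm_parity_linext2 _ _ _ hu hv).
- exact: fm_parity0.
- by move=> c a b; apply: fm_parityP.
move=> m n <- <-; rewrite /smon_parity -oddD -size_cat.
exact: normal_form_parity.
Qed.

Lemma supercomm_gen_parity x : supercomm_parity (gen_parity x) (supercomm_gen x).
Proof. by case: x => a /=; apply: normal_form_parity. Qed.

(* The augmentation ideal. *)
Definition omega : {pred supercomm} := [pred u | u@_smon1 == 0].

Lemma smon_gen x : exists2 m : smon, m != smon1 & supercomm_gen x = fm_basis K m.
Proof.
case: x => [y|z].
  exists (@SMon _ _ Y Z ([:: y], [::]) isT) => //=.
  by rewrite (normal_formU (SMon _)).
exists (@SMon _ _ Y Z ([::], [:: z]) isT) => //=.
by rewrite (normal_formU (SMon _)).
Qed.

Lemma omegaP (P : supercomm -> Prop) u : u \in omega ->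
  P 0 -> (forall (c : K) a b, P a -> P b -> P (c *: a + b)) ->
  (forall m, m != smon1 -> u@_m != 0 -> P (fm_basis K m)) -> P u.
Proof.
move=> ou P0 PP Pm; rewrite [u]freemodE; apply: linext_ind => // m um.
by apply: Pm => //; apply: contraNneq um => ->.
Qed.

Lemma omega_gen x : supercomm_gen x \in omega.
Proof.
have [m ne ->] := smon_gen x.
by rewrite inE fmcoef_basis (eq_sym smon1) (negPf ne).
Qed.

Lemma omegaM u v : u \in omega -> v \in omega -> u * v \in omega.
Proof.
have O0 : (0 : supercomm) \in omega by rewrite inE fmcoef0.
have OP (c : K) (a b : supercomm) :
    a \in omega -> b \in omega -> c *: a + b \in omega.
  by rewrite !inE fmcoefD fmcoefZ => /eqP-> /eqP->; rewrite mulr0 addr0.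
move=> ou ov.
have H := @omegaP (fun u => u * v \in omega) u ou.
apply: H => [|c a b oa ob|m nm _].
- by rewrite mul0r.
- by rewrite mulrDl -scalerAl OP.
have H := @omegaP (fun v => (fm_basis K m : supercomm) * v \in omega) v ov.
apply: H => [|c a b oa ob|n nn _].
- by rewrite mulr0.
- by rewrite mulrDr -scalerAr OP.
rewrite (normal_formU m) (normal_formU n) /GRing.mul /= normal_formM.
case: (normal_formE ((val m).1 ++ (val n).1) ((val m).2 ++ (val n).2));
  last by case=> _ ->.
case=> p [ep _ ->].
rewrite inE fmcoefZ fmcoef_basis.
suff /negPf-> : smon1 != p by rewrite mulr0.
apply: contra nm => /eqP e; rewrite -e in ep; apply/eqP; apply: val_inj.
move: ep => /=; case: (val m) => a b [] /(congr1 size) ea /(congr1 size) eb.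
by move: ea eb; rewrite !size_sort !size_cat /=; case: a; case: b.
Qed.

End SupercommutativeTheory.

Definition smon_pos (dY dZ : Order.disp_t) (Y : orderType dY)
    (Z : orderType dZ) : Type := {m : smon Y Z | m != smon1 Y Z}.
HB.instance Definition _ (dY dZ : Order.disp_t) (Y : orderType dY)
  (Z : orderType dZ) := Choice.on (smon_pos Y Z).

(* The tensor square of omega, as the space with basis the tensors m ⊗ n of
   non-unit monomials; see [tens_universal]. *)
Definition omega2 (dY dZ : Order.disp_t) (Y : orderType dY) (Z : orderType dZ)
    (K : fieldType) : Type := freemod K (smon_pos Y Z * smon_pos Y Z)%type.
HB.instance Definition _ (dY dZ : Order.disp_t) (Y : orderType dY)
  (Z : orderType dZ) (K : fieldType) := GRing.Lmodule.on (omega2 Y Z K).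

Definition pair_parity (dY dZ : Order.disp_t) (Y : orderType dY)
    (Z : orderType dZ) (pq : smon_pos Y Z * smon_pos Y Z) : bool :=
  smon_parity (val pq.1) (+) smon_parity (val pq.2).

(* For convenience u ⊗ v is defined for all u and v, discarding their constant
   terms; it is only meaningful for u and v in omega. *)
HB.lock Definition tens (dY dZ : Order.disp_t) (Y : orderType dY)
    (Z : orderType dZ) (K : fieldType) (u v : supercomm Y Z K) : omega2 Y Z K :=
  linext2 (fun m n =>
    match insub m, insub n with
    | Some p, Some q => fm_basis K (p : smon_pos Y Z, q : smon_pos Y Z)
    | _, _ => 0
    end) u v.
Arguments tens {dY dZ Y Z K} u v.
Notation "u ⊗ v" := (tens u v) (at level 45, no associativity) : super_scope.

Section Tensor.
Context (dY dZ : Order.disp_t) (Y : orderType dY) (Z : orderType dZ).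
Context (K : fieldType).
Local Notation smon := (smon Y Z).
Local Notation smon_pos := (smon_pos Y Z).
Local Notation supercomm := (supercomm Y Z K).
Local Notation omega2 := (omega2 Y Z K).
Local Notation omega := (@omega _ _ Y Z K).

Lemma tens_bilinear : bilinear_for *:%R *:%R (@tens _ _ Y Z K).
Proof. by rewrite tens.unlock; apply: linext2_bilinear. Qed.

Lemma tens0l (v : supercomm) : 0 ⊗ v = 0.
Proof.
have /eqP := tens_bilinear.1 v 1 0 0.
by rewrite /= !scale1r addr0 -subr_eq subrr => /eqP.
Qed.

Lemma tens0r (u : supercomm) : u ⊗ 0 = 0.
Proof.
have /eqP := tens_bilinear.2 u 1 0 0.
by rewrite /= !scale1r addr0 -subr_eq subrr => /eqP.
Qed.

Lemma tensU (p q : smon_pos) :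
  fm_basis K (val p) ⊗ fm_basis K (val q) = fm_basis K (p, q) :> omega2.
Proof. by rewrite tens.unlock linext2U !valK. Qed.

Lemma tens_universal (V : lmodType K) (f : supercomm -> supercomm -> V) :
  (forall c, {in omega & &, forall u u' v,
     f (c *: u + u') v = c *: f u v + f u' v}) ->
  (forall c, {in omega & &, forall u v v',
     f u (c *: v + v') = c *: f u v + f u v'}) ->
  exists phi : omega2 -> V,
    [/\ linear phi,
        {in omega &, forall u v, phi (u ⊗ v) = f u v} &
        forall psi : omega2 -> V, linear psi ->
          {in omega &, forall u v, psi (u ⊗ v) = f u v} -> psi =1 phi].
Proof.
move=> fl fr.
have [phi [lphi phiU]] : exists phi : omega2 -> V, linear phi /\
    forall p q : smon_pos, phi (fm_basis K (p, q)) =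
      f (fm_basis K (val p)) (fm_basis K (val q)).
  exists (linext (fun pq : smon_pos * smon_pos =>
    f (fm_basis K (val pq.1)) (fm_basis K (val pq.2)))).
  by split=> [c a b|p q]; [rewrite linearP | rewrite linextU].
have phi0 : phi 0 = 0.
  have /eqP := lphi 1 0 0.
  by rewrite !scale1r addr0 -subr_eq subrr => /eqP.
have basis_in m : m != smon1 Y Z -> fm_basis K m \in omega.
  by move=> nm; rewrite inE fmcoef_basis eq_sym (eq_sym _ m) (negPf nm).
have O0 : (0 : supercomm) \in omega by rewrite inE fmcoef0.
have OP (c : K) (a b : supercomm) :
    a \in omega -> b \in omega -> c *: a + b \in omega.
  by rewrite !inE fmcoefD fmcoefZ => /eqP-> /eqP->; rewrite mulr0 addr0.
have f0l v : v \in omega -> f 0 v = 0.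
  move=> ov; have /eqP := fl 1 0 0 v O0 O0 ov.
  by rewrite !scale1r addr0 -subr_eq subrr => /eqP.
have f0r u : u \in omega -> f u 0 = 0.
  move=> ou; have /eqP := fr 1 u 0 0 ou O0 O0.
  by rewrite !scale1r addr0 -subr_eq subrr => /eqP.
exists phi; split=> [|u v ou ov|psi lpsi hpsi].
- exact: lphi.
- have := @omegaP _ _ Y Z K
    (fun u => u \in omega /\ phi (u ⊗ v) = f u v) u ou.
  case=> [|c a b [oa ea] [ob eb]|m nm _|//].
  + by rewrite f0l // tens0l phi0.
  + split; first exact: OP.
    by rewrite (tens_bilinear.1 v c a b) lphi ea eb fl.
  split; first exact: basis_in.
  have := @omegaP _ _ Y Z K
    (fun v => v \in omega /\
       phi (fm_basis K m ⊗ v) = f (fm_basis K m) v) v ov.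
  case=> [|c a b [oa ea] [ob eb]|n nn _|//].
  + by rewrite f0r ?basis_in // tens0r phi0.
  + split; first exact: OP.
    rewrite (tens_bilinear.2 (fm_basis K m) c a b) lphi ea eb.
    by rewrite fr // basis_in.
  split; first exact: basis_in.
  by rewrite (tensU (Sub m nm) (Sub n nn)) phiU.
apply: freemod_lin_eq => // -[p q].
rewrite -[fm_basis K (p, q)]tensU hpsi ?basis_in ?(valP p) ?(valP q) //.
by rewrite tensU phiU.
Qed.

Lemma tens_parity i j (u v : supercomm) :
  supercomm_parity i u -> supercomm_parity j v ->
  fm_parity (@pair_parity _ _ Y Z) (i (+) j) (u ⊗ v).
Proof.
move=> hu hv; rewrite tens.unlock; apply: (fm_parity_linext2 _ _ _ hu hv).
- exact: fm_parity0.
- by move=> c a b; apply: fm_parityP.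
move=> m n <- <-; case: insubP => [p _ <-|_]; last exact: fm_parity0.
case: insubP => [q _ <-|_]; last exact: fm_parity0.
exact: fm_parity_basis.
Qed.

End Tensor.

Definition Gsup (dY dZ : Order.disp_t) (Y : orderType dY) (Z : orderType dZ)
    (K : fieldType) : Type := (freemod K (Y + Z)%type * omega2 Y Z K)%type.
HB.instance Definition _ (dY dZ : Order.disp_t) (Y : orderType dY)
  (Z : orderType dZ) (K : fieldType) := GRing.Lmodule.on (Gsup Y Z K).

Definition smon_vec (dY dZ : Order.disp_t) (Y : orderType dY)
    (Z : orderType dZ) (K : fieldType) (p : smon_pos Y Z) : supercomm Y Z K :=
  fm_basis K (val p).

(* The multiplication of G_sup(X) on the bases X of KX and (p, q) = p ⊗ q of
   omega ⊗ omega, extended bilinearly; the formulas for arbitrary homogeneous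
   elements are [gsup_genM], [gsup_gen_tens], [gsup_tens_gen], [gsup_tensM]. *)
HB.lock Definition gsup_mul (dY dZ : Order.disp_t) (Y : orderType dY)
    (Z : orderType dZ) (K : fieldType) (g h : Gsup Y Z K) : Gsup Y Z K :=
  let gen := @supercomm_gen _ _ Y Z K in
  let mon := @smon_vec _ _ Y Z K in
  (0,
     linext2 (fun x1 x2 => gen x1 ⊗ gen x2) g.1 h.1
   + linext2 (fun x q => (gen x * mon q.1) ⊗ mon q.2) g.1 h.2
   + linext2 (fun p x => mon p.1 ⊗ (mon p.2 * gen x)) g.2 h.1
   + linext2 (fun p q =>
       (-1) ^+ (smon_parity (val p.2) &&
                (smon_parity (val q.1) (+) smon_parity (val q.2))) *:
       ((mon p.1 * mon q.1) ⊗ (mon q.2 * mon p.2))) g.2 h.2).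
Arguments gsup_mul {dY dZ Y Z K} g h.

Section GsupTheory.
Context (dY dZ : Order.disp_t) (Y : orderType dY) (Z : orderType dZ).
Context (K : fieldType).
Local Notation smon_pos := (smon_pos Y Z).
Local Notation supercomm := (supercomm Y Z K).
Local Notation omega2 := (omega2 Y Z K).
Local Notation omega := (@omega _ _ Y Z K).
Local Notation Gsup := (Gsup Y Z K).

Definition gsup_parity (i : bool) (g : Gsup) : Prop :=
  fm_parity (@gen_parity Y Z) i g.1 /\
  fm_parity (@pair_parity _ _ Y Z) i g.2.

Lemma gsup_mul_bilinear : bilinear_for *:%R *:%R (@gsup_mul _ _ Y Z K).
Proof.
rewrite gsup_mul.unlock; split=> [h|g] c a b; apply: injective_projections;
  rewrite /= ?scaler0 ?addr0 // ?linext2Pl ?linext2Pr !scalerDr;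
  by rewrite (AC (2*2*2*2) ((1*3*5*7)*(2*4*6*8))).
Qed.

Lemma gsup_parity0 i : gsup_parity i 0.
Proof. by split; apply: fm_parity0. Qed.

Lemma gsup_parityP i (c : K) a b :
  gsup_parity i a -> gsup_parity i b -> gsup_parity i (c *: a + b).
Proof. by case=> ? ? [? ?]; split; apply: fm_parityP. Qed.

Lemma gsup_parity_sum a : exists a0 a1,
  [/\ gsup_parity false a0, gsup_parity true a1 & a = a0 + a1].
Proof.
have [u0 [u1 [? ? e1]]] := fm_parity_sum (@gen_parity Y Z) a.1.
have [v0 [v1 [? ? e2]]] := fm_parity_sum (@pair_parity _ _ Y Z) a.2.
exists (u0, v0), (u1, v1); split; [by split | by split |].
by rewrite [a]surjective_pairing e1 e2.
Qed.

Lemma gsup_parity_direct a : gsup_parity false a -> gsup_parity true a -> a = 0.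
Proof.
case=> h1 h2 [h3 h4]; rewrite [a]surjective_pairing.
by rewrite (fm_parity_direct h1 h3) (fm_parity_direct h2 h4).
Qed.

Lemma smon_vec_parity (p : smon_pos) :
  supercomm_parity (smon_parity (val p)) (smon_vec K p).
Proof. exact: fm_parity_basis. Qed.

Lemma gsup_parityM i j a b : gsup_parity i a -> gsup_parity j b ->
  gsup_parity (i (+) j) (gsup_mul a b).
Proof.
pose par : omega2 -> Prop := fm_parity (@pair_parity _ _ Y Z) (i (+) j).
have P0 : par 0 by exact: fm_parity0.
have PP (c : K) (u v : omega2) : par u -> par v -> par (c *: u + v).
  exact: fm_parityP.
case=> h1 h2 [h3 h4]; rewrite gsup_mul.unlock; split; first exact: fm_parity0.
have PD (u v : omega2) : par u -> par v -> par (u + v).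
  by move=> hu hv; rewrite -[u]scale1r; apply: PP.
apply: (PD); first apply: (PD); first apply: (PD).
- apply: (fm_parity_linext2 P0 PP _ h1 h3) => x y; rewrite /par => <- <-.
  by apply: tens_parity; apply: supercomm_gen_parity.
- apply: (fm_parity_linext2 P0 PP _ h1 h4) => x [p q]; rewrite /par => <- <-.
  rewrite /pair_parity addbA; apply: tens_parity; last exact: smon_vec_parity.
  apply: supercomm_parityM; last exact: smon_vec_parity.
  exact: supercomm_gen_parity.
- apply: (fm_parity_linext2 P0 PP _ h2 h3) => -[p q] x; rewrite /par => <- <-.
  rewrite /pair_parity -addbA; apply: tens_parity; first exact: smon_vec_parity.
  apply: supercomm_parityM; first exact: smon_vec_parity.
  exact: supercomm_gen_parity.
apply: (fm_parity_linext2 P0 PP _ h2 h4) => -[p q] [p' q'] dp dq.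
rewrite -[_ *: _]addr0; apply: PP => //; rewrite /par -dp -dq /pair_parity /=.
rewrite addbACA [X in _ (+) X]addbC.
by apply: tens_parity; apply: supercomm_parityM; apply: smon_vec_parity.
Qed.

HB.instance Definition _ := Lmodule_isSuperalgebra.Build K Gsup
  gsup_mul_bilinear gsup_parity0 gsup_parityP gsup_parity_sum
  gsup_parity_direct gsup_parityM.

Definition gsup_gen (x : Y + Z) : Gsup := (fm_basis K x, 0).
Definition gsup_tens (t : omega2) : Gsup := (0, t).

Lemma gsup_genM x1 x2 : gsup_gen x1 ∘ gsup_gen x2 =
  gsup_tens (supercomm_gen K x1 ⊗ supercomm_gen K x2).
Proof.
rewrite /smul /= gsup_mul.unlock /= linext2U !linext20l !linext20r.
by rewrite !addr0.
Qed.

Let smon_inv m : m != smon1 Y Z -> exists p : smon_pos, m = val p.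
Proof. by move=> nm; exists (Sub m nm). Qed.

Let omega_ext (f g : supercomm -> Gsup) u : linear f -> linear g ->
  u \in omega ->
  (forall p : smon_pos, u@_(val p) != 0 ->
     f (smon_vec K p) = g (smon_vec K p)) ->
  f u = g u.
Proof.
move=> lf lg ou fg.
have f0 (h : supercomm -> Gsup) : linear h -> h 0 = 0.
  move=> lh; have /eqP := lh 1 0 0.
  by rewrite !scale1r addr0 -subr_eq subrr => /eqP.
have H := @omegaP _ _ Y Z K (fun u => f u = g u) u ou; apply: H.
- by rewrite !f0.
- by move=> c a b ea eb; rewrite lf lg ea eb.
by move=> m /smon_inv[p ->]; apply: fg.
Qed.

Let gM_l (h : Gsup) : linear (fun g : Gsup => g ∘ h).
Proof. exact: gsup_mul_bilinear.1. Qed.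
Let gM_r (h : Gsup) : linear (fun g : Gsup => h ∘ g).
Proof. exact: gsup_mul_bilinear.2. Qed.
Let tens_l (v : supercomm) : linear (fun u => gsup_tens (u ⊗ v)).
Proof.
move=> c a b; rewrite ((@tens_bilinear _ _ Y Z K).1 v c a b).
by apply: injective_projections; rewrite /= ?scaler0 ?addr0.
Qed.
Let tens_r (v : supercomm) : linear (fun u => gsup_tens (v ⊗ u)).
Proof.
move=> c a b; rewrite ((@tens_bilinear _ _ Y Z K).2 v c a b).
by apply: injective_projections; rewrite /= ?scaler0 ?addr0.
Qed.

Lemma gsup_gen_tens x u v : u \in omega -> v \in omega ->
  gsup_gen x ∘ gsup_tens (u ⊗ v) = gsup_tens ((supercomm_gen K x * u) ⊗ v).
Proof.
move=> ou ov.
apply: (omega_ext (f := fun u => gsup_gen x ∘ gsup_tens (u ⊗ v))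
  (g := fun u => gsup_tens ((supercomm_gen K x * u) ⊗ v)) _ _ ou).
- by move=> c a b; rewrite tens_l gM_r.
- by move=> c a b; rewrite mulrDr -scalerAr tens_l.
move=> p _.
apply: (omega_ext (f := fun v => gsup_gen x ∘ gsup_tens (smon_vec K p ⊗ v))
  (g := fun v => gsup_tens ((supercomm_gen K x * smon_vec K p) ⊗ v)) _ _ ov).
- by move=> c a b; rewrite tens_r gM_r.
- exact: tens_r.
move=> q _; rewrite tensU /smul /= gsup_mul.unlock /=.
by rewrite linext2U !linext20l !linext20r !addr0 add0r.
Qed.

Lemma gsup_tens_gen x u v : u \in omega -> v \in omega ->
  gsup_tens (u ⊗ v) ∘ gsup_gen x = gsup_tens (u ⊗ (v * supercomm_gen K x)).
Proof.
move=> ou ov.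
apply: (omega_ext (f := fun u => gsup_tens (u ⊗ v) ∘ gsup_gen x)
  (g := fun u => gsup_tens (u ⊗ (v * supercomm_gen K x))) _ _ ou).
- by move=> c a b; rewrite tens_l gM_l.
- exact: tens_l.
move=> p _.
apply: (omega_ext (f := fun v => gsup_tens (smon_vec K p ⊗ v) ∘ gsup_gen x)
  (g := fun v => gsup_tens (smon_vec K p ⊗ (v * supercomm_gen K x))) _ _ ov).
- by move=> c a b; rewrite tens_r gM_l.
- by move=> c a b; rewrite mulrDl -scalerAl tens_r.
move=> q _; rewrite tensU /smul /= gsup_mul.unlock /=.
by rewrite linext2U !linext20l !linext20r !addr0 add0r.
Qed.

Lemma gsup_tensM (i2 j1 j2 : bool) u1 v1 u2 v2 :
  u1 \in omega -> v1 \in omega -> u2 \in omega -> v2 \in omega ->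
  supercomm_parity j1 v1 -> supercomm_parity i2 u2 -> supercomm_parity j2 v2 ->
  gsup_tens (u1 ⊗ v1) ∘ gsup_tens (u2 ⊗ v2) =
  (-1) ^+ (j1 && (i2 (+) j2)) *: gsup_tens ((u1 * u2) ⊗ (v2 * v1)).
Proof.
move=> ou1 ov1 ou2 ov2 hv1 hu2 hv2; set e := _ ^+ _.
have lin_scale (f : supercomm -> Gsup) : linear f -> linear (fun u => e *: f u).
  by move=> lf c a b; rewrite lf scalerDr !scalerA mulrC.
apply: (omega_ext (f := fun u1 => gsup_tens (u1 ⊗ v1) ∘ gsup_tens (u2 ⊗ v2))
  (g := fun u1 => e *: gsup_tens ((u1 * u2) ⊗ (v2 * v1))) _ _ ou1).
- by move=> c a b; rewrite tens_l gM_l.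
- by apply: lin_scale => c a b; rewrite mulrDl -scalerAl tens_l.
move=> p1 _.
apply: (omega_ext
  (f := fun v1 => gsup_tens (smon_vec K p1 ⊗ v1) ∘ gsup_tens (u2 ⊗ v2))
  (g := fun v1 => e *: gsup_tens ((smon_vec K p1 * u2) ⊗ (v2 * v1)))
  _ _ ov1).
- by move=> c a b; rewrite tens_r gM_l.
- by apply: lin_scale => c a b; rewrite mulrDr -scalerAr tens_r.
move=> q1 /hv1 eq1.
apply: (omega_ext
  (f := fun u2 => gsup_tens (smon_vec K p1 ⊗ smon_vec K q1) ∘
                  gsup_tens (u2 ⊗ v2))
  (g := fun u2 => e *: gsup_tens ((smon_vec K p1 * u2) ⊗ (v2 * smon_vec K q1)))
  _ _ ou2).
- by move=> c a b; rewrite tens_l gM_r.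
- by apply: lin_scale => c a b; rewrite mulrDr -scalerAr tens_l.
move=> p2 /hu2 ep2.
apply: (omega_ext
  (f := fun v2 => gsup_tens (smon_vec K p1 ⊗ smon_vec K q1) ∘
                  gsup_tens (smon_vec K p2 ⊗ v2))
  (g := fun v2 => e *: gsup_tens
    ((smon_vec K p1 * smon_vec K p2) ⊗ (v2 * smon_vec K q1))) _ _ ov2).
- by move=> c a b; rewrite tens_r gM_r.
- by apply: lin_scale => c a b; rewrite mulrDl -scalerAl tens_r.
move=> q2 /hv2 eq2; rewrite !tensU /smul /= gsup_mul.unlock /=.
rewrite linext2U !linext20l !linext20r !add0r /= eq1 ep2 eq2.
by apply: injective_projections; rewrite //= scaler0.
Qed.

End GsupTheory.

(* For p = (a_1 ... a_r, b_1 ... b_s) this is the nonassociative monomial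
   a_1 (a_2 (... (a_(r-1) (((a_r b_1) b_2) ... b_s)) ...)), evaluated in A at the
   generators [x i].  Letting p range over [smon_pos Y Z * smon_pos Y Z] gives
   exactly the set M: r = k + l > 0 and s = m + n > 0, the y's of each factor
   are nondecreasing and its z's increasing.  The last case of the match never
   occurs, since r > 0. *)
Definition bimonomial (dY dZ : Order.disp_t) (Y : orderType dY)
    (Z : orderType dZ) (K : fieldType) (A : superalgType K) (x : Y + Z -> A)
    (p : smon_pos Y Z * smon_pos Y Z) : A :=
  let bs := map x (smon_word (val p.2)) in
  match map x (smon_word (val p.1)) with
  | a :: s => foldr smul (foldl smul (last a s) bs) (belast a s)
  | [::] => 0
  end.

(* The family X ∪ M. *)
Definition XM (dY dZ : Order.disp_t) (Y : orderType dY) (Z : orderType dZ)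
    (K : fieldType) (A : superalgType K) (x : Y + Z -> A)
    (i : (Y + Z) + smon_pos Y Z * smon_pos Y Z) : A :=
  match i with
  | inl g => x g
  | inr p => bimonomial x p
  end.

(* Main.v *)
Require Import Defs.
From mathcomp Require Import all_boot all_order all_algebra finmap.

Set Implicit Arguments.
Unset Strict Implicit.
Unset Printing Implicit Defensive.

Import Order.TTheory GRing.Theory.
Local Open Scope ring_scope.
Local Open Scope super_scope.

(** Every bicommutative superalgebra A satisfies [a ((d e) b) = (a (d e)) b]
    ([smul_lrcomm]): on products, left multiplications commute with right
    multiplications without any sign.  Hence the monomial
    [a_1 (... (a_(r-1) (((a_r b_1) b_2) ... b_s)))] may be bracketed either
    from the b's or from the a's ([word_monomialE]); the first bracketing shows
    that exchanging neighbouring b's only costs the sign of super-commutation,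
    the second one shows the same for the a's, the innermost one included.

    A function of words that behaves in this way under exchange of neighbours
    factors through the free super-commutative superalgebra
    ([sign_swap_linext]); this is where characteristic different from 2 enters,
    as it makes a word with a repeated odd letter go to 0.  Applied to both
    words of a monomial, this turns the monomials of A into a linear map on
    [omega ⊗ omega] sending [a_1 ... a_r ⊗ b_1 ... b_s] to the monomial above,
    for arbitrary nonempty words ([gsup_lift_tens]).  The product of two such
    monomials is again one, with concatenated words and with exactly the sign
    occurring in the product of G_sup(X) ([word_monomialM]).  So every
    parity-preserving map from X to A extends to a homomorphism from G_sup(X)
    ([gsup_lift_superhom]).

    Conversely G_sup(X) is itself bicommutative.  The point of the computation
    is that a generator x acts on the left as [x ⊗ 1] and on the right as
    [1 ⊗ x], which makes all products of basis elements instances of a single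
    formula ([gsup_basisM]).  Evaluated at the generators of G_sup(X), the
    family X ∪ M is literally the standard basis of G_sup(X)
    ([gsup_XM_gen]), without signs.

    The universal property of F gives a homomorphism from F to G_sup(X), which
    is inverse to the extension of [iota]: on F by uniqueness, on G_sup(X) since
    the composite fixes the standard basis.  This isomorphism carries the
    standard basis of G_sup(X) to X ∪ M in F. *)

(** * Linear maps, bases and free modules *)

Lemma linear_at0 (K : fieldType) (V W : lmodType K) (f : V -> W) :
  linear f -> f 0 = 0.
Proof.
move=> lf; apply: (addrI (f 0)).
by rewrite -[X in X + _]scale1r -lf scale1r !addr0.
Qed.

Lemma linear_lincomb (K : fieldType) (V W : lmodType K) (f : V -> W)
    (I : Type) (s : seq I) (c : I -> K) (v : I -> V) : linear f ->
  f (\sum_(i <- s) c i *: v i) = \sum_(i <- s) c i *: f (v i).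
Proof.
move=> lf; elim: s => [|i s IH]; first by rewrite !big_nil linear_at0.
by rewrite !big_cons lf IH.
Qed.

Lemma is_basis_iso (K : fieldType) (V W : lmodType K) (f : V -> W) (g : W -> V)
    (I : eqType) (v : I -> V) (w : I -> W) :
  linear f -> linear g -> cancel f g -> cancel g f -> f \o v =1 w ->
  is_basis v -> is_basis w.
Proof.
move=> lf lg fK gK fv [span free]; split=> [y|s c us E].
  have [s [c e]] := span (g y); exists s, c.
  rewrite -[y]gK e (linear_lincomb _ _ _ lf).
  by apply: eq_bigr => i _; rewrite -fv.
apply: free => //; apply: (can_inj fK); rewrite (linear_lincomb _ _ _ lf).
by rewrite (linear_at0 lf) -[RHS]E; apply: eq_bigr => i _; rewrite -fv.
Qed.

Lemma linext_eq (K : fieldType) (M : choiceType) (V : lmodType K)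
    (f g : M -> V) : f =1 g -> linext f =1 linext g.
Proof.
by move=> fg u; rewrite linext.unlock; apply: eq_bigr => m _; rewrite fg.
Qed.

Lemma fm_parity_ind (K : fieldType) (M : choiceType) (deg : M -> bool)
    (P : freemod K M -> Prop) i u : fm_parity deg i u ->
  P 0 -> (forall c a b, P a -> P b -> P (c *: a + b)) ->
  (forall m, deg m = i -> P (fm_basis K m)) -> P u.
Proof.
move=> hu P0 PP Pm; rewrite [u]freemodE; apply: linext_ind => // m /hu.
exact: Pm.
Qed.

(** * Sign-alternating functions of words *)

(** Adjacent transpositions generate all rearrangements: the first letter of
    the target is moved to the front, and the induction hypothesis is applied to
    the property of the remaining letters. *)
Lemma perm_adjacent_ind (T : eqType) (P : seq T -> Prop) :
  (forall s x y t, P (s ++ x :: y :: t) -> P (s ++ y :: x :: t)) ->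
  forall s t, perm_eq s t -> P s -> P t.
Proof.
move=> swapP s t; elim: t s P swapP => [|y t IH] s P swapP.
  by move/perm_nilP->.
move=> pst; have ys : y \in s by rewrite (perm_mem pst) mem_head.
case/splitPr: ys pst => s1 s2 pst Ps.
have pst' : perm_eq (s1 ++ s2) t.
  rewrite -(perm_cons y) -(permPr pst) perm_sym perm_catC /= perm_cons.
  by rewrite perm_catC.
apply: (IH (s1 ++ s2) (fun w => P (y :: w))) => // [u a b v|].
  exact: (swapP (y :: u)).
elim/last_ind: s1 s2 Ps {pst pst'} => [//|s1 x IHs] s2.
by rewrite !cat_rcons => /swapP/IHs.
Qed.

Lemma not_uniq_perm (T : eqType) (s : seq T) :
  ~~ uniq s -> exists x t, perm_eq s (x :: x :: t).
Proof.
elim: s => //= x s IH; rewrite negb_and negbK => /orP[xs|/IH[y [t p]]].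
  by exists x, (rem x s); rewrite perm_cons perm_to_rem.
exists y, (x :: t); rewrite -(cat1s x s) (permPl (permEl (perm_catC _ _))).
have -> : [:: y, y, x & t] = [:: y; y; x] ++ t by [].
rewrite -(perm_cat2r [:: x]) in p; apply: perm_trans p _.
rewrite /= !perm_cons; exact: permEl (perm_catC _ _).
Qed.

Section Words.
Context (dY dZ : Order.disp_t) (Y : orderType dY) (Z : orderType dZ).
Context (K : fieldType).
Local Notation X := (Y + Z)%type.
Local Notation supercomm := (supercomm Y Z K).
Local Notation smon_word := (@smon_word _ _ Y Z).
Local Notation gp := (@gen_parity Y Z).

(** The rule obeyed by the products of generators of a super-commutative
    superalgebra; [g] need not be multiplicative. *)
Definition sign_swap (V : lmodType K) (g : seq X -> V) : Prop :=
  forall s x y t, g (s ++ x :: y :: t) =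
    (-1) ^+ (gp x && gp y) *: g (s ++ y :: x :: t).

Definition gen_prod (w : seq X) : supercomm := \prod_(x <- w) supercomm_gen K x.

Lemma gen_prod1 x : gen_prod [:: x] = supercomm_gen K x.
Proof. exact: big_seq1. Qed.

Lemma gen_prod_cat s t : gen_prod (s ++ t) = gen_prod s * gen_prod t.
Proof. exact: big_cat. Qed.

Lemma gen_prod_cons x t : gen_prod (x :: t) = supercomm_gen K x * gen_prod t.
Proof. exact: big_cons. Qed.

Lemma supercomm_gen_swap x y : supercomm_gen K x * supercomm_gen K y =
  (-1) ^+ (gp x && gp y) *: (supercomm_gen K y * supercomm_gen K x).
Proof.
case: x y => [x|x] [y|y]; rewrite [_ && _]/= ?expr0 ?scale1r.
- exact: supercomm_gen_comm.
- exact: supercomm_gen_comm.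
- by rewrite supercomm_gen_comm.
by rewrite supercomm_gen_anticomm expr1 scaleN1r.
Qed.

Lemma gen_prod_swap : sign_swap gen_prod.
Proof.
move=> s x y t; rewrite !gen_prod_cat !gen_prod_cons scalerAr; congr (_ * _).
by rewrite !mulrA supercomm_gen_swap -scalerAl.
Qed.

(** Exchanging the two equal odd letters shows that the value is its own
    opposite. *)
Lemma sign_swap_sq (V : lmodType K) (g : seq X -> V) s z t :
  2%N \notin [pchar K] -> sign_swap g -> g (s ++ inr z :: inr z :: t) = 0.
Proof.
move=> p2 gsw; have := gsw s (inr z) (inr z) t; rewrite /= scaleN1r => /eqP.
rewrite -addr_eq0 -mulr2n -scaler_nat scaler_eq0 => /orP[|/eqP//].
by move: p2; rewrite inE /= => /negPf->.
Qed.

Lemma perm_word (w : seq X) :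
  exists ys zs, perm_eq w (map inl ys ++ map inr zs).
Proof.
elim: w => [|[y|z] w [ys [zs p]]]; first by exists [::], [::].
  by exists (y :: ys), zs; rewrite /= perm_cons.
exists ys, (z :: zs); rewrite perm_sym (permPl (permEl (perm_catC _ _))) /=.
by rewrite perm_cons (permPl (permEl (perm_catC _ _))) perm_sym.
Qed.

(** Words modulo [sign_swap] are spanned by the standard monomials: both sides
    change by the same sign under exchange of neighbours, so it suffices to look
    at one rearrangement of [w].  If an odd letter is repeated, bringing two
    copies of it together annihilates both sides; otherwise [w] may be sorted
    into the word of a standard monomial. *)
Lemma sign_swap_linext (V : lmodType K) (g : seq X -> V) (w : seq X) :
  2%N \notin [pchar K] -> sign_swap g ->
  linext (fun m => g (smon_word m)) (gen_prod w) = g w.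
Proof.
move=> p2 gsw; set G := linext _.
have swapP s x y t : G (gen_prod (s ++ x :: y :: t)) = g (s ++ x :: y :: t) ->
    G (gen_prod (s ++ y :: x :: t)) = g (s ++ y :: x :: t).
  rewrite gen_prod_swap gsw [G _]linearZ /= => e.
  by apply: scalerI e; rewrite signr_eq0.
have [ys [zs pw]] := perm_word w.
have perm_w ys' zs' : perm_eq ys ys' -> perm_eq zs zs' ->
    perm_eq (map inl ys' ++ map inr zs') w.
  move=> py pz; rewrite perm_sym; apply: perm_trans pw _.
  by apply: perm_cat; apply: perm_map.
have [uz|/not_uniq_perm[z [t pz]]] := boolP (uniq zs); last first.
  have pw' := perm_w ys (z :: z :: t) (perm_refl _) pz.
  apply: (perm_adjacent_ind (P := fun w => G (gen_prod w) = g w) swapP pw').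
  rewrite (sign_swap_sq _ _ _ p2 gsw) (sign_swap_sq _ _ _ p2 gen_prod_swap).
  exact: linear0.
have sm : sorted <=%O (sort <=%O ys) && sorted <%O (sort <=%O zs).
  by rewrite sort_le_sorted smon_sorted_uniq.
pose m := @SMon _ _ Y Z (sort <=%O ys, sort <=%O zs) sm.
apply: (perm_adjacent_ind (P := fun w => G (gen_prod w) = g w) swapP
  (s := smon_word m)).
  by apply: perm_w; rewrite perm_sym perm_sort.
by rewrite -[gen_prod _](supercomm_monomialE K m) /G linextU.
Qed.

Definition word_parity (w : seq X) : bool :=
  foldr (fun x b => gp x (+) b) false w.

Lemma word_parity_cat s t :
  word_parity (s ++ t) = word_parity s (+) word_parity t.
Proof. by elim: s => //= x s ->; rewrite addbA. Qed.

Lemma word_parity_smon m : word_parity (smon_word m) = smon_parity m.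
Proof.
rewrite word_parity_cat /smon_parity.
have -> (ys : seq Y) : word_parity (map inl ys) = false by elim: ys.
by rewrite addFb; elim: (val m).2 => //= z zs ->.
Qed.

Lemma smon_pos_word (p : smon_pos Y Z) :
  exists a s, smon_word (val p) = a :: s.
Proof. by case: p => [[[[|y ys] [|z zs]] h] ne] //=; do 2!eexists. Qed.

Lemma gen_prod_superC s t : gen_prod s * gen_prod t =
  (-1) ^+ (word_parity s && word_parity t) *: (gen_prod t * gen_prod s).
Proof.
have gP x : supercomm_gen K x * gen_prod t =
    (-1) ^+ (gp x && word_parity t) *: (gen_prod t * supercomm_gen K x).
  elim: t => [|y t IH].
    by rewrite /gen_prod big_nil andbF scale1r mul1r mulr1.
  rewrite gen_prod_cons mulrA supercomm_gen_swap -scalerAl.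
  rewrite -!mulrA IH -scalerAr scalerA -signr_addb.
  by rewrite /= andb_addr.
elim: s => [|x s IH]; first by rewrite /gen_prod big_nil scale1r mul1r mulr1.
rewrite gen_prod_cons -mulrA IH -scalerAr.
rewrite [supercomm_gen K x * (_ * _)]mulrA gP -scalerAl.
by rewrite scalerA -signr_addb -mulrA addbC /= andb_addl.
Qed.

Lemma supercomm_superC i j (u v : supercomm) :
  supercomm_parity i u -> supercomm_parity j v ->
  u * v = (-1) ^+ (i && j) *: (v * u).
Proof.
move=> hu hv; apply: (fm_parity_ind
  (P := fun u : supercomm => u * v = _ *: (v * u)) hu) => [|c a b ea eb|m <-].
- by rewrite mul0r mulr0 scaler0.
- rewrite mulrDl mulrDr -scalerAl -scalerAr ea eb scalerDr !scalerA.
  by rewrite (mulrC c).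
apply: (fm_parity_ind
  (P := fun v : supercomm => _ * v = _ *: (v * _)) hv) => [|c a b ea eb|n <-].
- by rewrite mul0r mulr0 scaler0.
- rewrite mulrDl mulrDr -scalerAl -scalerAr ea eb scalerDr !scalerA.
  by rewrite (mulrC c).
rewrite !supercomm_monomialE -!word_parity_smon; exact: gen_prod_superC.
Qed.

End Words.

(** * Words in a bicommutative superalgebra *)

Section Superalgebra.
Context (K : fieldType) (A : superalgType K).
Implicit Types a b c d e x y : A.

Lemma smulPl k a b c : (k *: a + b) ∘ c = k *: (a ∘ c) + b ∘ c.
Proof. exact: (@smul_bilinear K A).1. Qed.

Lemma smulPr k a b c : c ∘ (k *: a + b) = k *: (c ∘ a) + c ∘ b.
Proof. exact: (@smul_bilinear K A).2. Qed.

Lemma smulDl a b c : (a + b) ∘ c = a ∘ c + b ∘ c.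
Proof. by rewrite -[a]scale1r smulPl !scale1r. Qed.

Lemma smulDr a b c : c ∘ (a + b) = c ∘ a + c ∘ b.
Proof. by rewrite -[a]scale1r smulPr !scale1r. Qed.

Lemma smul0l a : 0 ∘ a = 0.
Proof. by apply: (addrI (0 ∘ a)); rewrite -smulDl !addr0. Qed.

Lemma smul0r a : a ∘ 0 = 0.
Proof. by apply: (addrI (a ∘ 0)); rewrite -smulDr !addr0. Qed.

Lemma smulZl k a b : (k *: a) ∘ b = k *: (a ∘ b).
Proof. by rewrite -[k *: a]addr0 smulPl smul0l addr0. Qed.

Lemma smulZr k a b : a ∘ (k *: b) = k *: (a ∘ b).
Proof. by rewrite -[k *: b]addr0 smulPr smul0r addr0. Qed.

Lemma foldr_smulZ k a s : foldr smul (k *: a) s = k *: foldr smul a s.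
Proof. by elim: s => //= x s ->; rewrite smulZr. Qed.

Lemma foldl_smulZ k a s : foldl smul (k *: a) s = k *: foldl smul a s.
Proof. by elim: s a => //= x s IH a; rewrite smulZl IH. Qed.

Hypothesis bicom : bicommutative A.

(** Bicommutativity constrains homogeneous triples; by bilinearity the factor
    that is not moved may be arbitrary, here and in [smul_rcomm]. *)
Lemma smul_lcomm i j x y a : parity i x -> parity j y ->
  x ∘ (y ∘ a) = (-1) ^+ (i && j) *: (y ∘ (x ∘ a)).
Proof.
move=> hx hy; have [a0 [a1 [h0 h1 ->]]] := parity_sum a.
by rewrite !smulDr scalerDr (bicom hx hy h0).1 (bicom hx hy h1).1.
Qed.

Lemma smul_rcomm i j x y a : parity i x -> parity j y ->
  (a ∘ x) ∘ y = (-1) ^+ (i && j) *: ((a ∘ y) ∘ x).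
Proof.
move=> hx hy; have [a0 [a1 [h0 h1 ->]]] := parity_sum a.
by rewrite !smulDl scalerDr (bicom h0 hx hy).2 (bicom h1 hx hy).2.
Qed.

(** For homogeneous elements both sides reduce to [d ((a e) b)] with the sign of
    exchanging [a] and [d]: on the right in three exchanges, on the left by
    passing through [(a e) (d b)].  As no sign is left, homogeneity can be
    dropped. *)
Lemma smul_lrcomm a d e b : a ∘ ((d ∘ e) ∘ b) = (a ∘ (d ∘ e)) ∘ b.
Proof.
suff H i j k l a' d' e' b' : parity i a' -> parity j d' -> parity k e' ->
    parity l b' -> a' ∘ ((d' ∘ e') ∘ b') = (a' ∘ (d' ∘ e')) ∘ b'.
  have [a0 [a1 [ha0 ha1 ->]]] := parity_sum a; rewrite !smulDl.
  have [d0 [d1 [hd0 hd1 ->]]] := parity_sum d; rewrite !(smulDl, smulDr).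
  have [e0 [e1 [he0 he1 ->]]] := parity_sum e; rewrite !(smulDl, smulDr).
  have [b0 [b1 [hb0 hb1 ->]]] := parity_sum b; rewrite !smulDr.
  by do !congr (_ + _); apply: H; eassumption.
move=> ha hd he hb.
transitivity ((-1) ^+ (i && j) *: (d' ∘ ((a' ∘ e') ∘ b'))).
  rewrite (smul_lcomm _ ha (parityM _ _ _ _ hd he)).
  rewrite (smul_rcomm _ he (parityM _ _ _ _ ha hb)).
  rewrite (smul_lcomm _ hd ha) smulZl.
  rewrite (smul_rcomm _ (parityM _ _ _ _ hd hb) he).
  rewrite (smul_lcomm _ (parityM _ _ _ _ ha he) hd) (smul_rcomm _ he hb) smulZr.
  rewrite !scalerA -!signr_addb; congr (_ *: _); congr (_ ^+ nat_of_bool _).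
  by move: i j k l {ha hd he hb} => [] [] [] [].
rewrite (smul_rcomm _ (parityM _ _ _ _ hd he) hb).
rewrite (smul_lcomm _ (parityM _ _ _ _ ha hb) hd).
rewrite (smul_rcomm _ hb he) smulZr.
rewrite !scalerA -!signr_addb; congr (_ *: _); congr (_ ^+ nat_of_bool _).
by move: i j k l {ha hd he hb} => [] [] [] [].
Qed.

Lemma foldr_smul_product d e s : exists d' e', foldr smul (d ∘ e) s = d' ∘ e'.
Proof.
by case: s => [|x s] /=; [exists d, e | exists x, (foldr smul (d ∘ e) s)].
Qed.

Lemma foldl_smul_product d e s : exists d' e', foldl smul (d ∘ e) s = d' ∘ e'.
Proof. by elim: s d e => [|x s IH] d e /=; [exists d, e | apply: IH]. Qed.

Lemma foldr_smulR d e b s :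
  foldr smul ((d ∘ e) ∘ b) s = foldr smul (d ∘ e) s ∘ b.
Proof.
elim: s => //= x s ->; have [d' [e' ->]] := foldr_smul_product d e s.
exact: smul_lrcomm.
Qed.

Lemma foldlr_smul d e s t :
  foldl smul (foldr smul (d ∘ e) s) t = foldr smul (foldl smul (d ∘ e) t) s.
Proof.
elim/last_ind: t => // t b IH; rewrite !foldl_rcons IH.
by have [d' [e' ->]] := foldl_smul_product d e t; rewrite foldr_smulR.
Qed.

End Superalgebra.

Section WordMonomial.
Context (dY dZ : Order.disp_t) (Y : orderType dY) (Z : orderType dZ).
Context (K : fieldType) (A : superalgType K).
Context (x : Y + Z -> A).
Local Notation X := (Y + Z)%type.
Local Notation gp := (@gen_parity Y Z).
Implicit Types s t : seq X.

(** The monomial [((a_1 (... (a_r b_1))) b_2) ... b_s], bracketed from the a's.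
    The value 0 on empty words matches the convention that [u ⊗ v] discards
    constant terms. *)
Definition word_monomial s t : A :=
  match map x s, map x t with
  | a :: s', b :: t' => foldl smul (foldr smul b (a :: s')) t'
  | _, _ => 0
  end.

Lemma word_monomial0r s : word_monomial s [::] = 0.
Proof. by rewrite /word_monomial; case: map. Qed.

Hypotheses (bicom : bicommutative A) (xpar : parity_preserving x).

(** The same monomial bracketed from the b's: the factors a_1, ..., a_(r-1)
    commute past b_2, ..., b_s because they act on the product a_r b_1. *)
Lemma word_monomialE a s b t : word_monomial (a :: s) (b :: t) =
  foldr smul (foldl smul (x (last a s)) (map x (b :: t))) (map x (belast a s)).
Proof.
by rewrite /word_monomial [a :: s]lastI map_rcons -foldlr_smul // -foldr_rcons;
  case: belast.
Qed.

Lemma bimonomialE (p : smon_pos Y Z * smon_pos Y Z) :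
  bimonomial x p = word_monomial (smon_word (val p.1)) (smon_word (val p.2)).
Proof.
have [a [s es]] := smon_pos_word p.1; have [b [t et]] := smon_pos_word p.2.
by rewrite /bimonomial es et word_monomialE /= last_map belast_map.
Qed.

Lemma word_monomial_product a s b t :
  exists d e, word_monomial (a :: s) (b :: t) = d ∘ e.
Proof. exact: foldl_smul_product. Qed.

Lemma word_monomial_swapl t : sign_swap (word_monomial^~ t).
Proof.
move=> s a b s'; case: t => [|c t]; first by rewrite !word_monomial0r scaler0.
have E s1 : s1 != [::] -> word_monomial s1 (c :: t) =
    foldl smul (foldr smul (x c) (map x s1)) (map x t) by case: s1.
rewrite !E; try by case: s.
rewrite !map_cat !foldr_cat /= (smul_lcomm bicom _ (xpar a) (xpar b)).
by rewrite foldr_smulZ foldl_smulZ.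
Qed.

Lemma word_monomial_swapr s : sign_swap (word_monomial s).
Proof.
move=> t a b t'; case: s => [|c s]; first by rewrite /word_monomial scaler0.
have E t1 : t1 != [::] -> word_monomial (c :: s) t1 =
    foldr smul (foldl smul (x (last c s)) (map x t1)) (map x (belast c s)).
  by case: t1 => // *; exact: word_monomialE.
rewrite !E; try by case: t.
by rewrite !map_cat !foldl_cat /= (smul_rcomm bicom _ (xpar a) (xpar b))
  foldl_smulZ foldr_smulZ.
Qed.

Lemma word_monomial_cons a a' s t :
  word_monomial (a :: a' :: s) t = x a ∘ word_monomial (a' :: s) t.
Proof.
case: t => [|b t]; first by rewrite !word_monomial0r smul0r.
by rewrite !word_monomialE.
Qed.

Lemma word_monomial_rcons b b' s t :
  word_monomial s (rcons (b :: t) b') = word_monomial s (b :: t) ∘ x b'.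
Proof.
case: s => [|a s]; first by rewrite /word_monomial smul0l.
by rewrite /word_monomial /= map_rcons foldl_rcons.
Qed.

Lemma word_monomial_parity s t :
  parity (word_parity s (+) word_parity t) (word_monomial s t).
Proof.
case: s => [|a s]; first exact: parity0.
case: t => [|b t]; first by rewrite word_monomial0r; exact: parity0.
elim/last_ind: t => [|t b' IH]; last first.
  rewrite -rcons_cons word_monomial_rcons -cats1 word_parity_cat addbA.
  by apply: parityM => //=; rewrite addbF.
elim: s a => [|a' s IH] a.
  by rewrite /= !addbF; apply: parityM.
rewrite word_monomial_cons [word_parity _]/= -addbA.
exact: parityM (xpar a) (IH a').
Qed.

Lemma foldl_word_monomial s b t t' :
  foldl smul (word_monomial s (b :: t)) (map x t') =
  word_monomial s (b :: t ++ t').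
Proof.
case: s => [|a s]; last by rewrite /word_monomial /= map_cat foldl_cat.
by rewrite /word_monomial /=; elim: t' => //= c t'; rewrite smul0l.
Qed.

Lemma foldr_word_monomial s a s' t :
  foldr smul (word_monomial (a :: s') t) (map x s) =
  word_monomial (s ++ a :: s') t.
Proof.
elim: s => [//|c s IH]; rewrite [LHS]/= IH.
by case: s {IH} => [|c' s]; rewrite [in RHS]word_monomial_cons.
Qed.

(** A right factor [c] moves inwards past all the b's by right commutativity. *)
Lemma foldl_smul_parity i c d t : parity i c ->
  foldl smul d (map x t) ∘ c =
  (-1) ^+ (i && word_parity t) *: foldl smul (d ∘ c) (map x t).
Proof.
move=> hc; elim/last_ind: t => [|t b IH] /=; first by rewrite andbF scale1r.
rewrite map_rcons !foldl_rcons (smul_rcomm bicom _ (xpar b) hc) IH smulZl.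
rewrite scalerA -signr_addb -cats1 word_parity_cat /= addbF andb_addr.
by rewrite andbC addbC.
Qed.

(** With [c] the second monomial, bring [c] next to a_r: it moves out of the
    a's without sign, since these act on a product, and then past the b's with
    the sign of super-commutation.  What remains is [c] multiplied on the left by
    the a's and then on the right by the b's, which explains why the b's of the
    first factor come last. *)
Lemma word_monomialM a s b t a' s' b' t' :
  word_monomial (a :: s) (b :: t) ∘ word_monomial (a' :: s') (b' :: t') =
  (-1) ^+ (word_parity (b :: t) &&
           (word_parity (a' :: s') (+) word_parity (b' :: t'))) *:
  word_monomial (a :: s ++ a' :: s') (b' :: t' ++ b :: t).
Proof.
have hc := word_monomial_parity (a' :: s') (b' :: t').
set c := word_monomial _ _ in hc *; set i := (_ (+) _) in hc *.
have [d [e ec]] : exists d e, c = d ∘ e by exact: word_monomial_product.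
rewrite word_monomialE.
have [d1 [e1 E1]] : exists d1 e1,
    foldl smul (x (last a s)) (map x (b :: t)) = d1 ∘ e1.
  exact: foldl_smul_product.
rewrite E1 -foldr_smulR // -E1 (foldl_smul_parity _ _ hc) foldr_smulZ andbC.
congr (_ *: _); rewrite ec -foldlr_smul // -ec.
rewrite -foldr_rcons -map_rcons -lastI.
by rewrite (foldr_word_monomial (a :: s)) (foldl_word_monomial _ _ _ (b :: t)).
Qed.

End WordMonomial.

(** * The superalgebra G_sup(X) is bicommutative *)

Section Gsup.
Context (dY dZ : Order.disp_t) (Y : orderType dY) (Z : orderType dZ).
Context (K : fieldType).
Local Notation X := (Y + Z)%type.
Local Notation supercomm := (supercomm Y Z K).
Local Notation smon_pos := (smon_pos Y Z).
Local Notation Gsup := (Gsup Y Z K).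
Local Notation omega := (@omega _ _ Y Z K).
Local Notation smon_word := (@smon_word _ _ Y Z).
Local Notation gp := (@gen_parity Y Z).
Local Notation gen_prod := (@gen_prod _ _ Y Z K).
Implicit Type k : (X + smon_pos * smon_pos)%type.

Definition gsup_basis k : Gsup :=
  match k with
  | inl x => gsup_gen K x
  | inr p => gsup_tens (fm_basis K p)
  end.

Definition basis_parity k : bool :=
  match k with inl x => gp x | inr p => pair_parity p end.

Lemma smon_vecE (p : smon_pos) : smon_vec K p = gen_prod (smon_word (val p)).
Proof. exact: supercomm_monomialE. Qed.

Lemma gsup_basis_tens (p : smon_pos * smon_pos) :
  gsup_basis (inr p) = gsup_tens (smon_vec K p.1 ⊗ smon_vec K p.2).
Proof. by case: p => p q; rewrite /gsup_basis -tensU. Qed.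

Lemma gsup_tens_is_linear : linear (@gsup_tens _ _ Y Z K).
Proof.
by move=> c a b; apply: injective_projections; rewrite /= ?scaler0 ?addr0.
Qed.

Lemma gsup_gen_linear :
  linear (fun u : freemod K X => (u, 0) : Gsup).
Proof.
by move=> c a b; apply: injective_projections; rewrite /= ?scaler0 ?addr0.
Qed.

Lemma gsup_split (g : Gsup) : g = (g.1, 0) + gsup_tens g.2.
Proof. by apply: injective_projections; rewrite /= ?addr0 ?add0r. Qed.

Lemma gsup_parity_ind (P : Gsup -> Prop) i g : parity i g ->
  P 0 -> (forall c a b, P a -> P b -> P (c *: a + b)) ->
  (forall k, basis_parity k = i -> P (gsup_basis k)) -> P g.
Proof.
case=> h1 h2 P0 PP Pk; rewrite [g]gsup_split -[(_, 0)]scale1r.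
apply: (PP); [move: h1; move: g.1 | move: h2; move: g.2] => u hu.
  apply: (fm_parity_ind (P := fun u => P (u, 0)) hu) => // [c a b|m hm].
    by rewrite (gsup_gen_linear c a b); exact: PP.
  exact: (Pk (inl m)).
apply: (fm_parity_ind (P := fun u => P (gsup_tens u)) hu) => // [c a b|m hm].
  by rewrite gsup_tens_is_linear; exact: PP.
exact: (Pk (inr m)).
Qed.

Lemma gsup_lin_eq (V : lmodType K) (f g : Gsup -> V) :
  linear f -> linear g -> (forall k, f (gsup_basis k) = g (gsup_basis k)) ->
  f =1 g.
Proof.
move=> lf lg fg h; rewrite [h]gsup_split -[(_, 0)]scale1r lf lg.
congr (_ *: _ + _).
  apply: (freemod_lin_eq (f := fun u => f (u, 0)) (g := fun u => g (u, 0))).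
  - by move=> c a b; rewrite (gsup_gen_linear c a b) lf.
  - by move=> c a b; rewrite (gsup_gen_linear c a b) lg.
  by move=> m; exact: (fg (inl m)).
apply: (freemod_lin_eq (f := fun u => f (gsup_tens u))
  (g := fun u => g (gsup_tens u))).
- by move=> c a b; rewrite (gsup_tens_is_linear c a b) lf.
- by move=> c a b; rewrite (gsup_tens_is_linear c a b) lg.
by move=> m; exact: (fg (inr m)).
Qed.

(** The basis element [k] multiplies from the left like the tensor [lfac k], and
    from the right like the tensor [rfac k]; for a generator these are [x ⊗ 1]
    and [1 ⊗ x], whose unit components lie outside [omega]. *)
Definition lfac k : supercomm * supercomm :=
  match k with
  | inl x => (supercomm_gen K x, 1)
  | inr p => (smon_vec K p.1, smon_vec K p.2)
  end.

Definition rfac k : supercomm * supercomm :=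
  match k with
  | inl x => (1, supercomm_gen K x)
  | inr p => (smon_vec K p.1, smon_vec K p.2)
  end.

Definition lpar k : bool * bool :=
  match k with
  | inl x => (gp x, false)
  | inr p => (smon_parity (val p.1), smon_parity (val p.2))
  end.

Definition rpar k : bool * bool :=
  match k with
  | inl x => (false, gp x)
  | inr p => (smon_parity (val p.1), smon_parity (val p.2))
  end.

Lemma supercomm_parity1 : supercomm_parity false (1 : supercomm).
Proof. exact: (@fm_parity_basis K _ (@smon_parity _ _ Y Z) (smon1 Y Z)). Qed.

Lemma lparP k : supercomm_parity (lpar k).1 (lfac k).1 /\
                supercomm_parity (lpar k).2 (lfac k).2.
Proof.
case: k => [x|p]; split.
- exact: supercomm_gen_parity.
- exact: supercomm_parity1.
- exact: smon_vec_parity.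
exact: smon_vec_parity.
Qed.

Lemma rparP k : supercomm_parity (rpar k).1 (rfac k).1 /\
                supercomm_parity (rpar k).2 (rfac k).2.
Proof.
case: k => [x|p]; split.
- exact: supercomm_parity1.
- exact: supercomm_gen_parity.
- exact: smon_vec_parity.
exact: smon_vec_parity.
Qed.

Lemma basis_parity_l k : basis_parity k = (lpar k).1 (+) (lpar k).2.
Proof. by case: k => [x|p] //=; rewrite addbF. Qed.

Lemma basis_parity_r k : basis_parity k = (rpar k).1 (+) (rpar k).2.
Proof. by case: k => [x|p] //=; rewrite addbF. Qed.

Lemma smon_vec_omega (p : smon_pos) : smon_vec K p \in omega.
Proof.
by rewrite inE fmcoef_basis eq_sym (eq_sym _ (val p)) (negPf (valP p)).
Qed.

Lemma lr_omega k k' : (lfac k).1 * (rfac k').1 \in omega /\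
  (rfac k').2 * (lfac k).2 \in omega.
Proof.
case: k k' => [x|p] [y|q] /=; rewrite ?mulr1 ?mul1r; split;
  by rewrite ?omegaM ?smon_vec_omega ?omega_gen.
Qed.

Lemma gsup_tensZ c d (u v : supercomm) :
  gsup_tens ((c *: u) ⊗ (d *: v)) = (c * d) *: gsup_tens (u ⊗ v).
Proof.
have := (@tens_bilinear _ _ Y Z K).1 (d *: v) c u 0.
rewrite /= addr0 tens0l addr0 => ->.
have := (@tens_bilinear _ _ Y Z K).2 u d v 0.
rewrite /= addr0 tens0r addr0 => ->.
by rewrite scalerA; apply: injective_projections; rewrite /= ?scaler0.
Qed.

Lemma gsup_basis_tensM k i j u v : u \in omega -> v \in omega ->
  supercomm_parity i u -> supercomm_parity j v ->
  gsup_basis k ∘ gsup_tens (u ⊗ v) =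
  (-1) ^+ ((lpar k).2 && (i (+) j)) *:
    gsup_tens (((lfac k).1 * u) ⊗ (v * (lfac k).2)).
Proof.
move=> ou ov hu hv; case: k => [x|p].
  by rewrite gsup_gen_tens // mulr1 scale1r.
rewrite gsup_basis_tens; apply: gsup_tensM => //; try exact: smon_vec_omega.
exact: smon_vec_parity.
Qed.

Lemma gsup_tens_basisM k i j u v : u \in omega -> v \in omega ->
  supercomm_parity i u -> supercomm_parity j v ->
  gsup_tens (u ⊗ v) ∘ gsup_basis k =
  (-1) ^+ (j && basis_parity k) *:
    gsup_tens ((u * (rfac k).1) ⊗ ((rfac k).2 * v)).
Proof.
move=> ou ov hu hv; case: k => [x|p].
  rewrite gsup_tens_gen //.
  rewrite (supercomm_superC hv (@supercomm_gen_parity _ _ Y Z K x)).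
  by rewrite -[u]scale1r gsup_tensZ mul1r scale1r mulr1.
rewrite gsup_basis_tens; apply: gsup_tensM => //; try exact: smon_vec_omega;
  exact: smon_vec_parity.
Qed.

Lemma gsup_basisM k k' : gsup_basis k ∘ gsup_basis k' =
  (-1) ^+ ((lpar k).2 && basis_parity k') *:
    gsup_tens (((lfac k).1 * (rfac k').1) ⊗ ((rfac k').2 * (lfac k).2)).
Proof.
case: k' => [y|q]; last first.
  rewrite gsup_basis_tens.
  by apply: gsup_basis_tensM; try exact: smon_vec_omega; exact: smon_vec_parity.
case: k => [x|p]; first by rewrite gsup_genM !mulr1 scale1r.
rewrite gsup_basis_tens.
by apply: gsup_tens_basisM; try exact: smon_vec_omega; exact: smon_vec_parity.
Qed.

(** Up to sign both products are the tensor of the left factors of [k1] and [k2]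
    and the right factor of [k3], multiplied in opposite orders in the two
    components ([E]).  Super-commutation in each component then exchanges [k1]
    and [k2], and the comparison of signs is a Boolean identity in the
    parities of the components. *)
Lemma gsup_basis_lcomm k1 k2 k3 :
  gsup_basis k1 ∘ (gsup_basis k2 ∘ gsup_basis k3) =
  (-1) ^+ (basis_parity k1 && basis_parity k2) *:
    (gsup_basis k2 ∘ (gsup_basis k1 ∘ gsup_basis k3)).
Proof.
have E k k' : gsup_basis k ∘ (gsup_basis k' ∘ gsup_basis k3) =
    (-1) ^+ (((lpar k').2 && basis_parity k3) (+)
      ((lpar k).2 && (basis_parity k' (+) basis_parity k3))) *:
    gsup_tens (((lfac k).1 * (lfac k').1 * (rfac k3).1) ⊗
               ((rfac k3).2 * ((lfac k').2 * (lfac k).2))).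
  have [o1 o2] := lr_omega k' k3.
  have [p1 p2] := lparP k'; have [q1 q2] := rparP k3.
  rewrite gsup_basisM smulZr.
  rewrite (gsup_basis_tensM k o1 o2 (supercomm_parityM p1 q1)
    (supercomm_parityM q2 p2)).
  rewrite scalerA -signr_addb !mulrA (basis_parity_l k') (basis_parity_r k3).
  congr (_ *: _); congr (_ ^+ nat_of_bool _).
  by move: (lpar k') (lpar k) (rpar k3) => [[] []] [[] []] [[] []].
have [p1 p2] := lparP k1; have [q1 q2] := lparP k2.
rewrite !E (supercomm_superC p1 q1) (supercomm_superC q2 p2).
rewrite -scalerAl -scalerAr gsup_tensZ !scalerA -!signr_addb.
congr (_ *: _); congr (_ ^+ nat_of_bool _).
rewrite !basis_parity_l.
by move: (lpar k1) (lpar k2) (lpar k3) => [[] []] [[] []] [[] []].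
Qed.

Lemma gsup_basis_rcomm k1 k2 k3 :
  (gsup_basis k1 ∘ gsup_basis k2) ∘ gsup_basis k3 =
  (-1) ^+ (basis_parity k2 && basis_parity k3) *:
    ((gsup_basis k1 ∘ gsup_basis k3) ∘ gsup_basis k2).
Proof.
have E k k' : (gsup_basis k1 ∘ gsup_basis k) ∘ gsup_basis k' =
    (-1) ^+ (((lpar k1).2 && basis_parity k) (+)
      (((rpar k).2 (+) (lpar k1).2) && basis_parity k')) *:
    gsup_tens (((lfac k1).1 * ((rfac k).1 * (rfac k').1)) ⊗
               ((rfac k').2 * (rfac k).2 * (lfac k1).2)).
  have [o1 o2] := lr_omega k1 k.
  have [p1 p2] := lparP k1; have [q1 q2] := rparP k.
  rewrite gsup_basisM smulZl.
  rewrite (gsup_tens_basisM k' o1 o2 (supercomm_parityM p1 q1)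
    (supercomm_parityM q2 p2)).
  by rewrite scalerA -signr_addb !mulrA.
have [p1 p2] := rparP k2; have [q1 q2] := rparP k3.
rewrite !E (supercomm_superC p1 q1) (supercomm_superC q2 p2).
rewrite -scalerAl -scalerAr gsup_tensZ !scalerA -!signr_addb.
congr (_ *: _); congr (_ ^+ nat_of_bool _).
rewrite !basis_parity_r.
by move: (lpar k1).2 (rpar k2) (rpar k3) => [] [[] []] [[] []].
Qed.

Lemma gsup_bicommutative : bicommutative Gsup.
Proof.
move=> i1 i2 i3 x1 x2 x3 h1 h2 h3.
pose P (a b c : Gsup) :=
  a ∘ (b ∘ c) = (-1) ^+ (i1 && i2) *: (b ∘ (a ∘ c)) /\
  (a ∘ b) ∘ c = (-1) ^+ (i2 && i3) *: ((a ∘ c) ∘ b).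
have lin e (c : K) (u v u' v' : Gsup) : u = e *: v -> u' = e *: v' ->
    c *: u + u' = e *: (c *: v + v').
  by move=> -> ->; rewrite scalerDr !scalerA mulrC.
apply: (gsup_parity_ind (P := fun a => P a x2 x3) h1) =>
    [|c a b [a1 a2] [b1 b2]|k1 d1].
- by split; rewrite !(smul0l, smul0r) scaler0.
- by split; rewrite !(smulPl, smulPr); exact: lin.
apply: (gsup_parity_ind (P := fun a => P _ a x3) h2) =>
    [|c a b [a1 a2] [b1 b2]|k2 d2].
- by split; rewrite !(smul0l, smul0r) scaler0.
- by split; rewrite !(smulPl, smulPr); exact: lin.
apply: (gsup_parity_ind (P := fun a => P _ _ a) h3) =>
    [|c a b [a1 a2] [b1 b2]|k3 d3].
- by split; rewrite !(smul0l, smul0r) scaler0.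
- by split; rewrite !(smulPl, smulPr); exact: lin.
rewrite /P -d1 -d2 -d3.
by split; [exact: gsup_basis_lcomm | exact: gsup_basis_rcomm].
Qed.

Lemma gsup_gen_preserving : parity_preserving (@gsup_gen _ _ Y Z K).
Proof. by move=> x; split; [exact: fm_parity_basis | exact: fm_parity0]. Qed.

Lemma gen_prod_omega a s : gen_prod (a :: s) \in omega.
Proof.
elim: s a => [|b s IH] a; first by rewrite gen_prod1 omega_gen.
by rewrite gen_prod_cons omegaM ?omega_gen.
Qed.

(** The formulas for [x ∘ (u ⊗ v)] and [(u ⊗ v) ∘ x] carry no sign, so a
    monomial can be built up letter by letter. *)
Lemma gsup_word_monomial a s b t :
  word_monomial (@gsup_gen _ _ Y Z K) (a :: s) (b :: t) =
  gsup_tens (gen_prod (a :: s) ⊗ gen_prod (b :: t)).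
Proof.
have bic := gsup_bicommutative.
elim/last_ind: t => [|t b' IH]; last first.
  rewrite -rcons_cons word_monomial_rcons IH gsup_tens_gen ?gen_prod_omega //.
  by rewrite -cats1 gen_prod_cat gen_prod1.
elim: s a => [|a' s IH] a; first by rewrite !gen_prod1 -gsup_genM.
rewrite word_monomial_cons // IH gsup_gen_tens ?gen_prod_omega //.
by rewrite -gen_prod_cons.
Qed.

Lemma gsup_XM_gen : XM (@gsup_gen _ _ Y Z K) =1 gsup_basis.
Proof.
case=> [x|p] //=; rewrite bimonomialE; last first.
- exact: gsup_bicommutative.
rewrite -/(gsup_basis (inr p)) gsup_basis_tens !smon_vecE.
have [a [s ->]] := smon_pos_word p.1; have [b [t ->]] := smon_pos_word p.2.
exact: gsup_word_monomial.
Qed.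

Lemma gsup_basis_is_basis : is_basis gsup_basis.
Proof.
split=> [g|s c us E].
  pose c k := match k with inl x => g.1@_x | inr p => g.2@_p end.
  exists (map inl (fmsupp g.1) ++ map inr (fmsupp g.2)), c.
  rewrite big_cat !big_map /= [LHS]gsup_split; congr (_ + _).
    rewrite {1}[g.1]freemodE linext.unlock.
    rewrite (big_morph (fun u : freemod K X => (u, 0) : Gsup)
      (id1 := 0) (op1 := +%R)) //; last first.
      by move=> u v; rewrite -[u]scale1r gsup_gen_linear !scale1r.
    apply: eq_bigr => x _.
    by apply: injective_projections; rewrite //= scaler0.
  rewrite {1}[g.2]freemodE linext.unlock.
  rewrite (big_morph (@gsup_tens _ _ Y Z K)
    (id1 := 0) (op1 := +%R)) //; last first.
    by move=> u v; rewrite -[u]scale1r gsup_tens_is_linear !scale1r.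
  apply: eq_bigr => x _.
  by apply: injective_projections; rewrite //= scaler0.
move=> k ks.
pose coef (g : Gsup) : K := match k with inl x => g.1@_x | inr p => g.2@_p end.
have coefP a (g h : Gsup) : coef (a *: g + h) = a * coef g + coef h.
  by rewrite /coef; case: (k) => [x|p] /=; rewrite fmcoefD fmcoefZ.
have coef0 : coef 0 = 0 by rewrite /coef; case: (k) => [x|p]; exact: fmcoef0.
have coefB k' : coef (gsup_basis k') = (k == k')%:R.
  rewrite /coef; case: (k) k' => [x|p] [y|q]; first exact: fmcoef_basis.
  - exact: fmcoef0.
  - exact: fmcoef0.
  exact: fmcoef_basis.
have : coef (\sum_(i <- s) c i *: gsup_basis i) =
    \sum_(i <- s) c i * (k == i)%:R.
  elim: (s) => [|i r IH]; first by rewrite !big_nil.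
  by rewrite !big_cons coefP IH coefB.
rewrite E coef0 (bigD1_seq k) //= eqxx mulr1 big1 ?addr0 // => i.
by rewrite eq_sym => /negPf->; rewrite mulr0.
Qed.

End Gsup.

(** * The universal property of G_sup(X) *)

Section Lift.
Context (dY dZ : Order.disp_t) (Y : orderType dY) (Z : orderType dZ).
Context (K : fieldType) (A : superalgType K) (x : Y + Z -> A).
Local Notation Gsup := (Gsup Y Z K).
Local Notation smon_word := (@smon_word _ _ Y Z).
Local Notation gen_prod := (@gen_prod _ _ Y Z K).

Definition gsup_lift (g : Gsup) : A :=
  linext x g.1 + linext (bimonomial x) g.2.

Lemma gsup_lift_is_linear : linear gsup_lift.
Proof.
by move=> c a b; rewrite /gsup_lift !linearP /= scalerDr addrACA.
Qed.

Lemma gsup_lift_gen a : gsup_lift (gsup_gen K a) = x a.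
Proof. by rewrite /gsup_lift linextU linear0 addr0. Qed.

Lemma gsup_lift_basis k : gsup_lift (gsup_basis K k) = XM x k.
Proof.
case: k => [a|p]; first exact: gsup_lift_gen.
by rewrite /gsup_lift linear0 add0r linextU.
Qed.

Hypothesis p2 : 2%N \notin [pchar K].
Hypotheses (bicom : bicommutative A) (xpar : parity_preserving x).

(** The two factors of the tensor are treated one after the other by
    [sign_swap_linext]. *)
Lemma gsup_lift_tens s t :
  gsup_lift (gsup_tens (gen_prod s ⊗ gen_prod t)) = word_monomial x s t.
Proof.
pose B := linext2 (K := K) (fun m n =>
  word_monomial x (smon_word m) (smon_word n)).
transitivity (B (gen_prod s) (gen_prod t)); last first.
  rewrite /B /linext2
    (linext_eq (g := fun m => word_monomial x (smon_word m) t)).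
    exact: (sign_swap_linext s p2 (word_monomial_swapl bicom xpar t)).
  by move=> m; apply: (sign_swap_linext t p2 (word_monomial_swapr bicom xpar _)).
rewrite /gsup_lift linear0 add0r; move: (gen_prod s) (gen_prod t) => u v.
move: u; apply: freemod_lin_eq => [c a b|c a b|m].
- by rewrite ((@tens_bilinear _ _ Y Z K).1 v c a b) linearP.
- exact: linext2Pl.
move: v; apply: freemod_lin_eq => [c a b|c a b|n].
- by rewrite ((@tens_bilinear _ _ Y Z K).2 _ c a b) linearP.
- exact: linext2Pr.
rewrite /B tens.unlock !linext2U.
case: insubP => [p _ <-|]; last first.
  by rewrite negbK => /eqP->; rewrite linear0.
case: insubP => [q _ <-|]; last first.
  by rewrite negbK => /eqP->; rewrite linear0 word_monomial0r.
by rewrite linextU bimonomialE.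
Qed.

Lemma gsup_liftM : {morph gsup_lift : g h / g ∘ h}.
Proof.
move=> g h; move: g; apply: gsup_lin_eq => [c a b|c a b|k].
- by rewrite smulPl gsup_lift_is_linear.
- by rewrite gsup_lift_is_linear smulPl.
move: h; apply: gsup_lin_eq => [c a b|c a b|k'].
- by rewrite smulPr gsup_lift_is_linear.
- by rewrite gsup_lift_is_linear smulPr.
rewrite !gsup_lift_basis.
case: k k' => [a|p] [b|q].
- by rewrite gsup_genM -!gen_prod1 gsup_lift_tens.
- rewrite gsup_basis_tens gsup_gen_tens ?smon_vec_omega // !smon_vecE.
  rewrite -gen_prod_cons gsup_lift_tens /= bimonomialE //.
  by have [c [s ->]] := smon_pos_word q.1; rewrite word_monomial_cons.
- rewrite gsup_basis_tens gsup_tens_gen ?smon_vec_omega // !smon_vecE.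
  rewrite -gen_prod1 -gen_prod_cat cats1 gsup_lift_tens /= bimonomialE //.
  by have [c [s ->]] := smon_pos_word p.2; rewrite word_monomial_rcons.
rewrite !gsup_basis_tens (gsup_tensM (smon_vec_omega _ _) (smon_vec_omega _ _)
  (smon_vec_omega _ _) (smon_vec_omega _ _)
  (@smon_vec_parity _ _ Y Z K p.2) (@smon_vec_parity _ _ Y Z K q.1)
  (@smon_vec_parity _ _ Y Z K q.2)).
rewrite -[_ *: _]addr0 gsup_lift_is_linear.
rewrite (linear_at0 gsup_lift_is_linear) addr0 !smon_vecE -!gen_prod_cat.
rewrite gsup_lift_tens /= !bimonomialE // -!word_parity_smon.
have [a [s ->]] := smon_pos_word p.1; have [b [t ->]] := smon_pos_word p.2.
have [a' [s' ->]] := smon_pos_word q.1; have [b' [t' ->]] := smon_pos_word q.2.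
by rewrite word_monomialM.
Qed.

Lemma gsup_lift_superhom : superhom gsup_lift.
Proof.
split; [exact: gsup_lift_is_linear | exact: gsup_liftM | move=> i g hg].
apply: (gsup_parity_ind (P := fun g => parity i (gsup_lift g)) hg).
- by rewrite /gsup_lift !linear0 addr0; exact: parity0.
- by move=> c a b ha hb; rewrite gsup_lift_is_linear; exact: parityP.
move=> k <-; rewrite gsup_lift_basis; case: k => [a|p] /=; first exact: xpar.
rewrite bimonomialE // /pair_parity -!word_parity_smon.
exact: word_monomial_parity.
Qed.

End Lift.

Lemma superhom_id (K : fieldType) (A : superalgType K) : superhom (@id A).
Proof. by split. Qed.

Lemma superhom_comp (K : fieldType) (A B C : superalgType K) (f : A -> B)
    (g : B -> C) : superhom f -> superhom g -> superhom (g \o f).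
Proof.
case=> lf mf pf [lg mg pg]; split=> [c a b|a b|i a /pf/pg//] /=.
  by rewrite lf lg.
by rewrite mf mg.
Qed.

Lemma superhom_XM (dY dZ : Order.disp_t) (Y : orderType dY) (Z : orderType dZ)
    (K : fieldType) (A B : superalgType K) (f : A -> B) (x : Y + Z -> A)
    (y : Y + Z -> B) :
  superhom f -> f \o x =1 y -> f \o XM x =1 XM y.
Proof.
move=> [lf mf _] fx [a|p]; first exact: fx.
have fmap w : map y w = map f (map x w).
  by rewrite -map_comp; apply/esym/eq_map.
rewrite /= /bimonomial !fmap.
case: (map x _) => [|a s] /=; first exact: linear_at0.
rewrite last_map belast_map; move: (map x _) (last a s) (belast a s) => t b u.
have fr c : f (foldr smul c u) = foldr smul (f c) (map f u).
  by elim: u => //= d u <-; rewrite mf.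
rewrite fr; congr foldr.
by elim: t b => //= d t IH b; rewrite IH mf.
Qed.

Theorem theorem2p7 (K : fieldType) (dY dZ : Order.disp_t)
    (Y : orderType dY) (Z : orderType dZ)
    (F : superalgType K) (iota : Y + Z -> F) :
  2%N \notin [pchar K]%R ->
  well_founded (fun y1 y2 : Y => (y1 < y2)%O) ->
  well_founded (fun z1 z2 : Z => (z1 < z2)%O) ->
  free_bicommutative iota ->
  is_basis (XM iota) /\ superisomorphic F (Gsup Y Z K).
Proof.
move=> p2 _ _ [bicF parF univ].
have [phi [hphi phiX _]] :=
  univ _ _ (@gsup_bicommutative _ _ Y Z K) (@gsup_gen_preserving _ _ Y Z K).
pose psi := gsup_lift iota.
have hpsi : superhom psi := gsup_lift_superhom p2 bicF parF.
have [[lphi _ _] [lpsi _ _]] := (hphi, hpsi).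
have phiK : cancel phi psi.
  have [e [_ _ uniq_e]] := univ _ _ bicF parF.
  move=> a; rewrite -[psi _]/((psi \o phi) a).
  rewrite (uniq_e _ (superhom_comp hphi hpsi)); last first.
    by move=> b; rewrite /= phiX /psi gsup_lift_gen.
  by rewrite -(uniq_e _ (superhom_id F)).
have psiK : cancel psi phi.
  apply: gsup_lin_eq => [c a b|//|k].
    by rewrite lpsi lphi.
  rewrite [psi _]gsup_lift_basis -gsup_XM_gen.
  exact: (superhom_XM hphi phiX k).
split; last by exists phi => //; exists psi.
apply: (is_basis_iso lpsi lphi psiK phiK) (gsup_basis_is_basis Y Z K) => k.
exact: gsup_lift_basis.
Qed.
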